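(* Let $[\widehat{0},\widehat{1}]$ be a graded Eulerian poset of rank $n+1$. Then $$ \operatorname{t}([\widehat{0},\widehat{1}),x)=\sum_w [w]\,\Phi_{[\widehat{0},\widehat{1}]}(c,d)\cdot \operatorname{t}(w,x), $$ where the summation runs over all $cd$-words $w$ of degree $n$, and $[w]\,\Phi$ denotes the coefficient of $w$ in $\Phi$. Here $\operatorname{t}(w,x)$ is the total weight of all $\lambda=(\lambda_1,\dots,\lambda_n)\in\{-1,1\}^n$ such that the set of positions covered by letters $d$ in $w$ equals $R(\lambda)\cup(R(\lambda)-1)$ and $\lambda_1+\cdots+\lambda_i\geq 0$ holds for all $i\in[1,n]$. The weight of each such $\lambda$ is the product of the following factors: (1) each $\lambda_i=-1$ contributes a factor of $-1/x$; (2) each $\lambda_i=1$ contributes a factor of $x$; (3) each element of $R(\lambda)$ contributes an additional factor of $-1$.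
   Context: A graded poset is a finite poset with a unique minimum $\widehat{0}$, a unique maximum $\widehat{1}$ and a rank function $\rho:P\to\mathbb{N}$ with $\rho(\widehat{0})=0$ and $\rho(y)=\rho(x)+1$ whenever $y$ covers $x$; its rank is $\rho(\widehat{1})$. It is Eulerian if $\sum_{z\in[u,v]}(-1)^{\rho(z)}=0$ for all $u<v$. Write $[\widehat{0},p)=\{q: q<p\}$ and $[1,n]=\{1,\dots,n\}$. For $\lambda\in\{-1,1\}^n$, $R(\lambda)=\{i\in[1,n]:\lambda_1+\cdots+\lambda_i=0\}$ and $R(\lambda)-1=\{i-1:i\in R(\lambda)\}$. $cd$-words: words in the letters $c$ (degree $1$) and $d$ (degree $2$). In a $cd$-word of degree $n$, reading from left to right, each $c$ covers one position and each $d$ covers two consecutive positions of $[1,n]$. $cd$-index: for a graded poset $P$ of rank $n+1$ and $S\subseteq[1,n]$, let $f_S$ be the number of maximal chains of $P_S=\{u\in P:\rho(u)\in S\}$, and $h_S=\sum_{T\subseteq S}(-1)^{|S|-|T|}f_T$. The $ab$-index is $\sum_{S\subseteq[1,n]}h_Su_S$, where $u_S=u_1\cdots u_n$ is the word in noncommuting letters with $u_i=b$ if $i\in S$ and $u_i=a$ if $i\notin S$. If $P$ is Eulerian, the $ab$-index is (uniquely) a polynomial $\Phi_P(c,d)$ in the noncommuting variables $c=a+b$ and $d=ab+ba$, called the $cd$-index. Stanley's toric polynomials: $f(\emptyset,x)=g(\emptyset,x)=1$ ($\emptyset$ being $[\widehat{0},\widehat{1})$ for the Eulerian poset of rank $0$),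 and for an Eulerian poset of rank at least $1$, $$f([\widehat{0},\widehat{1}),x)=\sum_{p\in[\widehat{0},\widehat{1})} g([\widehat{0},p),x)(x-1)^{\rho(\widehat{1})-1-\rho(p)},$$ $$g([\widehat{0},\widehat{1}),x)=\sum_{i=0}^{\lfloor(\rho(\widehat{1})-1)/2\rfloor}\left([x^i]f([\widehat{0},\widehat{1}),x)-[x^{i-1}]f([\widehat{0},\widehat{1}),x)\right)x^i.$$ By a theorem of Stanley, if the rank is $n+1$ then $f([\widehat{0},\widehat{1}),x)$ has degree $n$ and satisfies $x^nf([\widehat{0},\widehat{1}),1/x)=f([\widehat{0},\widehat{1}),x)$. Short toric polynomial: for an Eulerian poset of rank $n+1$, $\operatorname{t}([\widehat{0},\widehat{1}),x)$ is the unique polynomial $q(x)$ of degree $n$ with $q(x)=(-1)^nq(-x)$ and $f([\widehat{0},\widehat{1}),x)=x^{n/2}\left(q(\sqrt{x})+q(1/\sqrt{x})-q(0)\right)$; equivalently, it is obtained from $x^{n}f([\widehat{0},\widehat{1}),x^{-2})$ by discarding all terms of negative degree. *)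

(* Defs.v *)
From Stdlib Require Import ClassicalEpsilon.
From HB Require Import structures.
From mathcomp Require Import all_boot all_order all_algebra.
From mathcomp Require Import finmap monalg.

Set Implicit Arguments.
Unset Strict Implicit.
Unset Printing Implicit Defensive.

Import Order.TTheory GRing.Theory Num.Theory.
Local Open Scope ring_scope.

(* Definite description.  The value is meaningless unless [P] is satisfied by  *)
(* exactly one element.                                                        *)
Definition the (A : Type) (a0 : A) (P : A -> Prop) : A :=
  epsilon (inhabits a0) P.

Lemma the_eq (A : Type) (a0 : A) (P : A -> Prop) (a : A) :
  P a -> (forall x, P x -> x = a) -> the a0 P = a.
Proof.
by move=> Pa Pu; apply: Pu; apply: epsilon_spec; exists a.
Qed.

(* Throughout, an ordinal i : 'I_n stands for the element i + 1 of [1,n].      *)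

Section Posets.
Context {d : Order.disp_t} {T : finTBPOrderType d}.
Implicit Types (rho : T -> nat) (p q u v : T).

Definition covers u v : bool :=
  (u < v)%O && [forall z, ~~ ((u < z)%O && (z < v)%O)].

Definition graded rho : Prop :=
  rho \bot%O = 0%N /\ forall u v, covers u v -> rho v = (rho u).+1.

Definition eulerian rho : Prop :=
  forall u v, (u < v)%O ->
    \sum_(z | (u <= z <= v)%O) (-1) ^+ rho z = 0 :> int.

Definition is_chain (C : {set T}) : bool :=
  [forall p in C, forall q in C, (p >=< q)%O].

Definition rank_selected rho n (S : {set 'I_n}) : {set T} :=
  [set u | [exists i in S, rho u == i.+1]].

Definition flag_f rho n (S : {set 'I_n}) : nat :=
  #|[set C | maxset (fun D : {set T} =>
       is_chain D && (D \subset rank_selected rho S)) C]|.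

Definition flag_h rho n (S : {set 'I_n}) : int :=
  \sum_(U : {set 'I_n} | U \subset S)
    (-1) ^+ (#|S| - #|U|) * (flag_f rho U)%:Z.

(* g([0,p),x) from f([0,p),x), for p of rank r >= 1                            *)
Definition toric_truncate (r : nat) (f : {poly rat}) : {poly rat} :=
  \sum_(i < (r.-1)./2.+1)
    (f`_i - (if (i : nat) is j.+1 then f`_j else 0)) *: 'X^i.

(* g([0,p),x), by recursion on an upper bound k of the cardinality of [0,p).   *)
Fixpoint toric_g_rec rho (k : nat) (p : T) {struct k} : {poly rat} :=
  if p == \bot%O then 1 else
  if k is k'.+1 then
    toric_truncate (rho p)
      (\sum_(q | (q < p)%O)
         toric_g_rec rho k' q * ('X - 1) ^+ (rho p - 1 - rho q))
  else 0.

Definition toric_g rho p : {poly rat} :=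
  toric_g_rec rho #|[set q | (q < p)%O]| p.

Definition toric_f rho p : {poly rat} :=
  if p == \bot%O then 1 else
    \sum_(q | (q < p)%O) toric_g rho q * ('X - 1) ^+ (rho p - 1 - rho q).

Lemma toric_g_rec_bound rho k p : (#|[set q | (q < p)%O]| <= k)%N ->
  toric_g_rec rho k p = toric_g rho p.
Proof.
rewrite /toric_g => le_pk; move: (leqnn #|[set q | (q < p)%O]|).
move: {2 3}#|[set q | (q < p)%O]| => m.
elim: k m p le_pk => [|k IH] m p le_pk le_pm.
  suff -> : p = \bot%O by case: m {le_pm} => [|m] /=; rewrite eqxx.
  apply/eqP/negPn/negP => p_neq0; move: le_pk.
  rewrite leqn0 cards_eq0 => /eqP/setP/(_ \bot%O).
  by rewrite !inE lt0x p_neq0.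
case: m le_pm => [|m] le_pm /=; case: eqP => // /eqP p_neq0.
  move: le_pm; rewrite leqn0 cards_eq0 => /eqP/setP/(_ \bot%O).
  by rewrite !inE lt0x p_neq0.
congr toric_truncate; apply: eq_bigr => q lt_qp; congr (_ * _).
have lt_card : (#|[set r | (r < q)%O]| < #|[set r | (r < p)%O]|)%N.
  apply: proper_card; apply/properP; split.
    by apply/subsetP=> r; rewrite !inE => /lt_trans; apply.
  by exists q; rewrite !inE ?ltxx.
by apply: IH; rewrite -ltnS; apply: leq_trans lt_card _.
Qed.

Lemma toric_g_bot rho : toric_g rho \bot%O = 1.
Proof. by rewrite /toric_g; case: #|_| => [|k] /=; rewrite eqxx. Qed.

Lemma toric_gE rho p : p != \bot%O ->
  toric_g rho p = toric_truncate (rho p) (toric_f rho p).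
Proof.
move=> p_neq0; rewrite -(@toric_g_rec_bound rho #|[set q | (q < p)%O]|.+1) //=.
rewrite /toric_f (negPf p_neq0); congr toric_truncate.
apply: eq_bigr => q lt_qp; congr (_ * _); apply: toric_g_rec_bound.
by apply/subset_leq_card/subsetP=> r; rewrite !inE => /lt_trans; apply.
Qed.

End Posets.

Variant ab_letter := La | Lb.
Variant cd_letter := Lc | Ld.

Definition bool_of_ab l := if l is La then false else true.
Definition ab_of_bool b := if b then Lb else La.
Lemma bool_of_abK : cancel bool_of_ab ab_of_bool. Proof. by case. Qed.
HB.instance Definition _ := Finite.copy ab_letter (can_type bool_of_abK).

Definition bool_of_cd l := if l is Lc then false else true.
Definition cd_of_bool b := if b then Ld else Lc.
Lemma bool_of_cdK : cancel bool_of_cd cd_of_bool. Proof. by case. Qed.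
HB.instance Definition _ := Finite.copy cd_letter (can_type bool_of_cdK).

(* Polynomials in noncommuting variables: the monoid algebra of a free monoid. *)
Notation ab_poly := {malg rat[{fmonom ab_letter}]}.
Notation cd_poly := {malg rat[{fmonom cd_letter}]}.

Definition ab_var (l : ab_letter) : ab_poly := << FMonom [:: l] >>.

Definition cd_value (l : cd_letter) : ab_poly :=
  let a := ab_var La in let b := ab_var Lb in
  if l is Lc then a + b else a * b + b * a.

(* Phi(a + b, ab + ba)                                                         *)
Definition cd_subst (Phi : cd_poly) : ab_poly :=
  mmap (fun r : rat => r%:MP)
       (fun w : {fmonom cd_letter} => \prod_(l <- (w : seq _)) cd_value l) Phi.

Definition cd_degree (w : seq cd_letter) : nat :=
  \sum_(l <- w) (if l is Lc then 1 else 2)%N.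

Section Indices.
Context {d : Order.disp_t} {T : finTBPOrderType d}.
Implicit Types (rho : T -> nat).

Definition ab_index rho n : ab_poly :=
  \sum_(S : {set 'I_n})
    (flag_h rho S)%:~R *: \prod_(i < n) ab_var (if i \in S then Lb else La).

Definition cd_index rho n : cd_poly :=
  the 0 (fun Phi : cd_poly => cd_subst Phi = ab_index rho n).

End Indices.

Notation ratfun := {fraction {poly rat}}.
Notation "p %:F" := (@FracField.tofrac _ p) : ring_scope.

Definition eval_ratfun (p : {poly rat}) (y : ratfun) : ratfun :=
  (map_poly (fun r : rat => r%:P%:F) p).[y].

(* The relation f(x) = x^(n/2) (q(sqrt x) + q(1/sqrt x) - q(0)) is stated with *)
(* the indeterminate 'X in the role of sqrt x, hence 'X^2 in that of x.        *)
Definition is_short_toric (n : nat) (f q : {poly rat}) : Prop :=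
  [/\ size q = n.+1,
      q = (-1) ^+ n *: (q \Po - 'X) &
      eval_ratfun f ('X%:F ^+ 2) =
        'X%:F ^+ n *
          (eval_ratfun q 'X%:F + eval_ratfun q ('X%:F)^-1 - eval_ratfun q 0)].

Definition short_toric {d : Order.disp_t} {T : finTBPOrderType d}
    (rho : T -> nat) n : {poly rat} :=
  the 0 (is_short_toric n (toric_f rho \top%O)).

Section SignSequences.
Variable n : nat.
Implicit Types (lam : {ffun 'I_n -> bool}) (w : seq cd_letter).

(* A sign sequence is encoded by booleans: [true] is 1, [false] is -1.         *)
Definition sign_val (b : bool) : int := if b then 1 else -1.

Definition partial_sum lam (i : 'I_n) : int :=
  \sum_(j < n | (j <= i)%N) sign_val (lam j).

Definition return_set lam : {set 'I_n} := [set i | partial_sum lam i == 0].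

Definition pred_set (A : {set 'I_n}) : {set 'I_n} :=
  [set i : 'I_n | [exists j in A, j == i.+1 :> nat]].

Definition d_mask w : bitseq :=
  flatten [seq (if l is Lc then [:: false] else [:: true; true]) | l <- w].

Definition d_positions w : {set 'I_n} := [set i : 'I_n | nth false (d_mask w) i].

Definition weight (K : fieldType) (x : K) lam : K :=
  (\prod_(i < n) (if lam i then x else -1 / x)) *
  \prod_(i in return_set lam) (-1).

Definition short_toric_word (K : fieldType) (x : K) w : K :=
  \sum_(lam : {ffun 'I_n -> bool} |
         (d_positions w == return_set lam :|: pred_set (return_set lam)) &&
         [forall i, 0 <= partial_sum lam i]) weight x lam.

End SignSequences.

(* Main.v *)
(* The recursion defining Stanley's toric polynomial only sees the ab-index.    *)
(* Write e = a - b and let Psi(t) be the ab-index of [0,t], expanded over the   *)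
(* chains of the open interval; splitting a chain at its largest element gives  *)
(*   Psi(t) = e^(rho(t)-1) + sum_(0<s<t) Psi(s) b e^(rho(t)-rho(s)-1).          *)
(* Hence f([0,t)) = L(Psi(t)) for the linear functional L defined on ab-words   *)
(* by L(1) = 1, L(u b) = g(L(u)), L(u e) = (x-1) L(u), where g is the           *)
(* truncation producing g([0,t)) from f([0,t)).                                 *)
(*   Existence of the cd-index: with zeta the zeta function and                 *)
(* nu = 2 (zeta-1) (zeta+1)^-1, one gets                                        *)
(*   Psi(t) = sum_(s<t) (delta_(s,0) + Psi(s) c/2) nu(s,t) e^(rho(t)-rho(s)-1), *)
(* and conjugation by (-1)^rho maps zeta to its inverse in an Eulerian poset,   *)
(* hence nu to -nu; so only even powers of e occur, and e^2 = c^2 - 2d.         *)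
(*   On a cd-word w of degree n, L(w) is palindromic.  If q is its short form   *)
(* (low coefficients of x^n L(w)(x^-2)), then appending c replaces q by the     *)
(* part of positive degree of (x - 1/x) q, and appending d replaces q by the    *)
(* constant q_0 - q_2.  Extending a nonnegative path by a step that avoids 0,   *)
(* or by two steps ending at 0, obeys the same rules.                           *)

From Stdlib Require Import ClassicalEpsilon.
Require Import Defs.
From HB Require Import structures.
From mathcomp Require Import all_boot all_order all_algebra.
From mathcomp Require Import finmap monalg.
From mathcomp Require Import ssrAC zify ring lra.

Set Implicit Arguments.
Unset Strict Implicit.
Unset Printing Implicit Defensive.

Import Order.TTheory GRing.Theory Num.Theory.
Local Open Scope ring_scope.

(** * Chains in graded posets *)

(** The toric polynomial f depends only on the ab-index. Splitting every chain at its largest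
    element shows that the ab-index, written as [chain_sum] ([ab_index_chain_sum]), satisfies the
    recursion that defines f, so f is its image under a linear functional [toric_ab]
    ([toric_f_chain_sum]). For an Eulerian poset the ab-index is a polynomial in c and d
    ([chain_sum_cd_generated]), hence f is a combination of the values of the functional on
    cd-words, with the coefficients of the cd-index ([toric_ab_cd_subst]).

    These values are computed letter by letter. Each is palindromic, hence determined by its short
    form q. Appending c replaces q_k by q_(k-1) - q_(k+1) for k > 0 and by 0 for k = 0; appending d
    leaves only the constant q_0 - q_2 ([short_coef_step_c], [short_coef_step_d]). The signed count
    of admissible paths ending at height k follows the same rules ([path_coef_c], [path_coef_d]), so
    the two agree ([path_coef_toric]).

    Palindromicity of f and its leading coefficient 1 ([lead_toric_f]) identify [short_toric] with
    the short form ([short_toricE]). As the short form is linear in f, summing over words ends the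
    proof. *)

Section GradedPoset.
Context {d : Order.disp_t} {T : finTBPOrderType d}.
Variables (rho : T -> nat) (rho_graded : graded rho).

(** Induction on the number of elements strictly between: unless v covers u, an intermediate z
    splits the interval into two smaller ones. *)
Lemma graded_between (u v : T) : (u < v)%O ->
  (rho u < rho v)%N /\
  forall i, (rho u < i < rho v)%N -> exists2 z, (u < z < v)%O & rho z = i.
Proof.
have [m le_m] := ubnP #|[set z | (u < z < v)%O]|.
elim: m u v le_m => // m IH u v le_m lt_uv.
have [cov|] := boolP (covers u v).
  rewrite (rho_graded.2 _ _ cov); split=> // i; lia.
rewrite /covers lt_uv /= => /forallPn[z /negPn/andP[lt_uz lt_zv]].
have card_lt x y : (u <= x)%O -> (y <= v)%O -> ~~ (x < z < y)%O ->
    (#|[set t | (x < t < y)%O]| < m)%N.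
  move=> le_ux le_yv nz; rewrite -ltnS; apply: leq_trans le_m.
  rewrite ltnS; apply: proper_card; apply/properP; split.
    apply/subsetP=> t; rewrite !inE => /andP[/(le_lt_trans le_ux)-> lt_ty] /=.
    exact: lt_le_trans lt_ty le_yv.
  by exists z; rewrite !inE ?lt_uz.
have [||lt1 ex1] := IH u z => //.
  by apply: card_lt; rewrite ?lexx ?ltxx ?andbF // ltW.
have [||lt2 ex2] := IH z v => //.
  by apply: card_lt; rewrite ?lexx ?ltxx // ltW.
split=> [|i /andP[ui iv]]; first exact: ltn_trans lt2.
have [iz|zi|->] := ltngtP i (rho z); last by exists z; rewrite ?lt_uz.
  have [|t /andP[ut tz] rt] := ex1 i; first by rewrite ui.
  by exists t; rewrite // ut (lt_trans tz).
have [|t /andP[ut tz] rt] := ex2 i; first by rewrite zi.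
by exists t; rewrite // tz (lt_trans lt_uz).
Qed.

Lemma rank_lt (u v : T) : (u < v)%O -> (rho u < rho v)%N.
Proof. by case/graded_between. Qed.

Lemma rank_le (u v : T) : (u <= v)%O -> (rho u <= rho v)%N.
Proof. by rewrite le_eqVlt => /predU1P[->//|/rank_lt/ltnW]. Qed.

Lemma rank_gt0 (u : T) : (0 < rho u)%N = (u != \bot%O).
Proof.
apply/idP/idP => [|u0]; first by apply: contraTneq => ->; rewrite rho_graded.1.
by rewrite -[X in (X < _)%N]rho_graded.1 rank_lt // lt0x.
Qed.

Lemma comparable_rank_lt (u v : T) :
  (u >=< v)%O -> (rho u < rho v)%N = (u < v)%O.
Proof.
move=> cuv; apply/idP/idP => [lt_r|]; last exact: rank_lt.
by rewrite comparable_ltNge //; apply: contraL lt_r => /rank_le; rewrite leqNgt.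
Qed.

Lemma comparable_rank_eq (u v : T) : (u >=< v)%O -> rho u = rho v -> u = v.
Proof. by move=> /comparable_ltgtP[/rank_lt|/rank_lt|->//] /[swap] ->; rewrite ltnn. Qed.

Definition inner_chain (t : T) (C : {set T}) : bool :=
  is_chain C && [forall p in C, (\bot < p < t)%O].

Definition hits_rank (C : {set T}) (i : nat) : bool :=
  [exists p in C, rho p == i].

Lemma is_chainP (C : {set T}) :
  reflect {in C &, forall p q, (p >=< q)%O} (is_chain C).
Proof.
apply: (iffP forall_inP) => [H p q pC qC|H p pC].
  by have /forall_inP := H p pC; apply.
by apply/forall_inP => q; apply: H.
Qed.

Lemma inner_chainP (t : T) (C : {set T}) :
  reflect (is_chain C /\ {in C, forall p, (\bot < p < t)%O}) (inner_chain t C).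
Proof. by apply: (iffP andP) => -[-> H]; split=> //; apply/forall_inP. Qed.

Definition rank_set n (C : {set T}) : {set 'I_n} := [set i : 'I_n | hits_rank C i.+1].

(** If the rank were missed, take the nearest chain elements below and above it, with [\bot] and
    [\top] as sentinels. An element of the missing rank between them is comparable to the whole
    chain, against maximality. *)
Lemma max_chain_hits n (S : {set 'I_n}) (C : {set T}) (i : 'I_n) :
    rho \top%O = n.+1 ->
    maxset (fun D : {set T} => is_chain D && (D \subset rank_selected rho S)) C ->
  i \in S -> hits_rank C i.+1.
Proof.
move=> rank_top /maxsetP[/andP[/is_chainP chC CS] Cmax] iS.
apply: contraT; rewrite /hits_rank negb_exists_in => /forall_inP nhit.
case: (@arg_maxnP _ \bot%O (fun p => (p \in \bot%O |: C) && (rho p < i.+1)%N) rho).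
  by rewrite !inE eqxx rho_graded.1.
move=> u /andP[uC ui] umax.
case: (@arg_minnP _ \top%O (fun p => (p \in \top%O |: C) && (i.+1 < rho p)%N) rho).
  by rewrite !inE eqxx rank_top ltnS ltn_ord.
move=> v /andP[vC vi] vmin.
have lt_uv : (u < v)%O.
  rewrite -comparable_rank_lt; first exact: ltn_trans vi.
  move: uC vC; rewrite !inE => /predU1P[->|uC] /predU1P[->|vC].
  - by apply: le_comparable; exact: le0x.
  - by apply: le_comparable; exact: le0x.
  - by apply: le_comparable; exact: lex1.
  exact: chC.
have [_ /(_ i.+1)] := graded_between lt_uv.
rewrite ui vi => -[//|z /andP[uz zv] rz].
have zNC : z \notin C by apply/negP => /nhit; rewrite rz eqxx.
have cz q : q \in C -> (z >=< q)%O.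
  move=> qC; have := nhit q qC; rewrite neq_ltn => /orP[qi|iq].
    apply: ge_comparable; apply: le_trans (ltW uz).
    have uq : (u >=< q)%O.
      move: uC; rewrite !inE => /predU1P[->|uC]; last exact: chC.
      by apply: le_comparable; exact: le0x.
    have := umax q; rewrite !inE qC orbT qi => /(_ isT).
    by rewrite comparable_leNgt 1?comparable_sym // -comparable_rank_lt // -leqNgt.
  apply: le_comparable; apply: le_trans (ltW zv) _.
  have vq : (v >=< q)%O.
    move: vC; rewrite !inE => /predU1P[->|vC]; last exact: chC.
    by apply: ge_comparable; exact: lex1.
  have := vmin q; rewrite !inE qC orbT iq => /(_ isT).
  by rewrite comparable_leNgt // -comparable_rank_lt 1?comparable_sym // -leqNgt.
have := Cmax (z |: C); rewrite subsetUr => /(_ _ isT) eqC.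
suff: z \in C by rewrite (negPf zNC).
rewrite -eqC ?setU11 //; apply/andP; split.
  apply/is_chainP => p q; rewrite !inE.
  case/predU1P=> [->|pC] /predU1P[->|qC].
  - exact: comparablexx.
  - exact: cz.
  - by rewrite comparable_sym; apply: cz.
  exact: chC.
rewrite subUset CS andbT sub1set inE; apply/exists_inP; exists i => //.
by rewrite rz.
Qed.

(** A maximal chain meets every selected rank. Conversely, a chain meeting all of them cannot grow,
    since a new element would share its rank with an old one. *)
Lemma flag_f_chains n (S : {set 'I_n}) : rho \top%O = n.+1 ->
  flag_f rho S = #|[set C | inner_chain \top%O C && (rank_set n C == S)]|.
Proof.
move=> rank_top; apply: eq_card => C; rewrite !inE; apply/idP/idP.
  move=> Cmax; have := Cmax; case/maxsetP => /andP[chC CS] _.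
  have sel p : p \in C -> exists2 i, i \in S & rho p = i.+1.
    by move=> /(subsetP CS); rewrite inE => /exists_inP[i iS /eqP]; exists i.
  apply/andP; split.
    apply/inner_chainP; split => // p /sel[i _ rp].
    rewrite lt0x -rank_gt0 rp /= lt_neqAle lex1 andbT.
    apply/eqP => pt; have := ltn_ord i.
    by rewrite -ltnS -rp pt rank_top ltnn.
  rewrite eqEsubset; apply/andP; split; apply/subsetP => i.
    rewrite inE => /exists_inP[p /sel[j jS ->]]; rewrite eqSS => /eqP/val_inj.
    by move=> <-.
  by rewrite inE; apply: max_chain_hits.
case/andP=> /inner_chainP[chC Cin] /eqP <-.
apply/maxsetP; split.
  rewrite chC; apply/subsetP => p pC; rewrite inE.
  have /andP[p0 /rank_lt] := Cin p pC; rewrite rank_top ltnS.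
  move: p0; rewrite lt0x -rank_gt0; case rp: (rho p) => [//|i] _ lt_in.
  apply/exists_inP; exists (Ordinal lt_in) => //=.
  by rewrite inE; apply/exists_inP; exists p => //; apply/eqP.
move=> D /andP[/is_chainP chD DS] CD; apply/eqP; rewrite eqEsubset CD andbT.
apply/subsetP => p pD; have := subsetP DS p pD; rewrite inE.
case/exists_inP => i; rewrite inE => /exists_inP[q qC /eqP rq] /eqP rp.
suff -> : p = q by [].
apply: comparable_rank_eq; last by rewrite rq.
by apply: chD => //; apply: (subsetP CD).
Qed.

End GradedPoset.

(** * Scalars and products in noncommutative polynomials *)

Section FreeMonoidAlgebra.
Variables (I : choiceType) (R : comNzRingType).
Implicit Types (p q : {malg R[{fmonom I}]}) (c : R).

Lemma malg_commC c p : p * c%:MP = c%:MP * p.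
Proof.
rewrite [LHS]fgmulgU [RHS]fgmulUg; apply: eq_bigr => k _.
by rewrite mulm1 mul1m mulrC.
Qed.

Lemma malg_scalerAr c p q : c *: (p * q) = p * (c *: q).
Proof. by rewrite -!mul_malgC !mulrA malg_commC. Qed.

(* The library makes a monoid algebra an [algType] only for commutative monoids. *)
Lemma malg_scaler_prod (J : Type) (r : seq J) (F : J -> R)
    (G : J -> {malg R[{fmonom I}]}) :
  \prod_(j <- r) (F j *: G j) = (\prod_(j <- r) F j) *: \prod_(j <- r) G j.
Proof.
elim/big_rec3: _ => [|j x y z _ ->]; first by rewrite scale1r.
by rewrite -scalerAl -malg_scalerAr scalerA.
Qed.

Lemma malgUM c1 c2 (k1 k2 : {fmonom I}) :
  << c1 *g k1 >> * << c2 *g k2 >> = << c1 * c2 *g mmul k1 k2 >>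
    :> {malg R[{fmonom I}]}.
Proof. exact: fgmulUU. Qed.

End FreeMonoidAlgebra.

(** * Weighted sums over chains *)

Section ChainSum.
Context {d : Order.disp_t} {T : finTBPOrderType d}.
Variables (rho : T -> nat) (rho_graded : graded rho).
Variables (A : nzRingType) (b e : A).

Definition chain_weight m (C : {set T}) : A :=
  \prod_(i < m) (if hits_rank rho C i.+1 then b else e).

(** For the letter b and e = a - b this is Psi(t), the ab-index of [0,t]. *)
Definition chain_sum (t : T) : A :=
  \sum_(C | inner_chain t C) chain_weight (rho t).-1 C.

Definition chain_top (C : {set T}) : T :=
  odflt \bot%O [pick p in C | [forall q in C, (q <= p)%O]].

Lemma chain_topP (C : {set T}) : is_chain C -> C != set0 ->
  chain_top C \in C /\ {in C, forall q, (q <= chain_top C)%O}.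
Proof.
move=> /is_chainP chC /set0Pn[x xC]; rewrite /chain_top; case: pickP => /= [p|].
  by case/andP=> pC /forall_inP.
case: (@arg_maxnP _ x (mem C) rho xC) => m mC mmax /(_ m) /negbT.
rewrite (mC : m \in C) /= => /forall_inPn[q qC].
rewrite comparable_leNgt ?chC // negbK => /(rank_lt rho_graded).
by rewrite ltnNge; have /= -> := mmax q qC.
Qed.

Lemma chain_top_eq (C : {set T}) p :
  is_chain C -> p \in C -> {in C, forall q, (q <= p)%O} -> chain_top C = p.
Proof.
move=> chC pC pmax; have [|tC tmax] := chain_topP chC.
  by apply/set0Pn; exists p.
by apply: le_anti; rewrite pmax // tmax.
Qed.

(** Adding s is a bijection from the chains below s to the chains below t with largest element s.
    The last conjunct encodes that s is not in C, in the shape produced by [reindex_onto]. *)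
Lemma inner_chain_extend (s t : T) (C : {set T}) : (\bot < s < t)%O ->
  inner_chain s C = (inner_chain t (s |: C) && (chain_top (s |: C) == s))
     && ((s |: C) :\ s == C).
Proof.
move=> /andP[s0 st]; apply/idP/idP.
  case/inner_chainP => chC inC.
  have sNC : s \notin C by apply/negP => /inC; rewrite ltxx andbF.
  have chsC : is_chain (s |: C).
    have lts p : p \in C -> (p < s)%O by move=> /inC /andP[].
    apply/is_chainP => p q; rewrite !inE => /predU1P[->|pC] /predU1P[->|qC].
    - exact: comparablexx.
    - by apply/ge_comparable/ltW/lts.
    - by apply/le_comparable/ltW/lts.
    by move/is_chainP: chC; apply.
  rewrite setU1K // eqxx andbT; apply/andP; split.
    apply/inner_chainP; split=> // p; rewrite !inE => /predU1P[->|/inC/andP[-> ps]].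
      by rewrite s0.
    exact: lt_trans st.
  apply/eqP/chain_top_eq => //; first by rewrite setU11.
  by move=> q; rewrite !inE => /predU1P[->|/inC/andP[_ /ltW]].
case/andP=> /andP[/inner_chainP[chsC inC] /eqP tops] /eqP eqC.
have [|_] := chain_topP chsC; first by apply/set0Pn; exists s; rewrite setU11.
rewrite tops => smax; apply/inner_chainP; split.
  apply/is_chainP => p q pC qC; move/is_chainP: chsC; apply; exact: setU1r.
move=> p pC; have /andP[-> _] := inC p (setU1r s pC) => /=.
rewrite lt_neqAle smax ?andbT; last exact: setU1r.
by move: pC; rewrite -eqC !inE => /andP[].
Qed.

(** Below the rank of s the hits are those of C, s itself gives the factor b, and no higher rank is
    hit. *)
Lemma chain_weight_extend (s t : T) (C : {set T}) :
  (\bot < s < t)%O -> inner_chain s C ->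
  chain_weight (rho t).-1 (s |: C) =
    chain_weight (rho s).-1 C * b * e ^+ (rho t - 1 - rho s).
Proof.
move=> /andP[s0 /(rank_lt rho_graded) lt_st] /inner_chainP[_ inC].
have rs : (0 < rho s)%N by rewrite rank_gt0 // -lt0x.
rewrite /chain_weight -!(big_mkord predT (fun i => if hits_rank rho _ i.+1 then b else e)).
have -> : (rho t).-1 = ((rho s).-1.+1 + (rho t - 1 - rho s))%N by lia.
rewrite (big_cat_nat (n := (rho s).-1.+1)) //=; last by lia.
have hitU i : hits_rank rho (s |: C) i = (rho s == i) || hits_rank rho C i.
  apply/exists_inP/orP => [[p]|[rsi|/exists_inP[p pC rp]]].
  - rewrite !inE => /predU1P[->|pC] rp; [by left|right].
    by apply/exists_inP; exists p.
  - by exists s; rewrite ?setU11.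
  - by exists p; rewrite ?setU1r.
congr (_ * _).
  rewrite big_nat_recr //= hitU prednK // eqxx /=; congr (_ * _).
  apply: eq_big_nat => i lt_i; rewrite hitU gtn_eqF //; lia.
rewrite -{1}[(rho s).-1.+1]add0n big_addn addKn -{2}[(_ - 1 - _)%N]subn0.
rewrite -prodr_const_nat; apply: eq_big_nat => i _.
rewrite hitU ltn_eqF /=; last by lia.
case: ifP => // /exists_inP[p /inC/andP[_ /(rank_lt rho_graded)]].
by move=> lt_ps /eqP; lia.
Qed.

(** The empty chain gives the pure power of e; the other chains are grouped by their largest element
    s. *)
Lemma chain_sum_rec (t : T) : t != \bot%O ->
  chain_sum t = e ^+ (rho t).-1 +
    \sum_(s | (\bot < s < t)%O) chain_sum s * b * e ^+ (rho t - 1 - rho s).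
Proof.
move=> t0; rewrite /chain_sum (bigD1 set0) /=; last first.
  by apply/inner_chainP; split; [apply/is_chainP|] => p; rewrite inE.
congr (_ + _).
  rewrite /chain_weight -[in RHS](card_ord (rho t).-1) -prodr_const.
  apply: eq_bigr => i _; case: ifP => // /exists_inP[p]; by rewrite inE.
rewrite (partition_big chain_top (fun s => (\bot < s < t)%O)) /=; last first.
  move=> C /andP[/inner_chainP[chC inC] C0].
  by have [tC _] := chain_topP chC C0; apply: inC.
apply: eq_bigr => s ins; rewrite -mulrA mulr_suml.
rewrite (reindex_onto (fun C => s |: C) (fun C => C :\ s)) /=; last first.
  move=> C /andP[/andP[/inner_chainP[chC _] C0] /eqP tops].
  by rewrite setD1K // -tops; case: (chain_topP chC C0).
apply: eq_big => [C|C inC].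
  have -> : s |: C != set0 by apply/set0Pn; exists s; rewrite setU11.
  by rewrite (inner_chain_extend _ ins) andbT.
rewrite mulrA; apply: chain_weight_extend => //; rewrite (inner_chain_extend _ ins).
by case/andP: inC => /andP[/andP[-> _] ->] ->.
Qed.

End ChainSum.

Local Notation va := (ab_var La).
Local Notation vb := (ab_var Lb).
Local Notation ve := (va - vb).

(** Expand the product on the right: S collects the positions where b is chosen, and each such
    choice outside U costs a sign. *)
Lemma prod_ab_sum_superset n (U : {set 'I_n}) :
  \sum_(S : {set 'I_n} | U \subset S) (-1) ^+ (#|S| - #|U|) *:
      \prod_(i < n) ab_var (if i \in S then Lb else La) =
  \prod_(i < n) (if i \in U then vb else ve).
Proof.
pose F (i : 'I_n) (j : bool) : ab_poly :=
  (if j then (if i \in U then 1 else -1) else (if i \in U then 0 else 1)) *: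
  ab_var (if j then Lb else La).
transitivity (\prod_(i < n) \sum_(j : bool) F i j); last first.
  apply: eq_bigr => i _; rewrite big_bool /F /=; case: ifP => _.
    by rewrite scale1r scale0r addr0.
  by rewrite scaleN1r scale1r addrC.
rewrite bigA_distr_bigA /= big_mkcond /=.
rewrite (reindex (fun f : {ffun 'I_n -> bool} => [set i | f i])) /=; last first.
  exists (fun S : {set 'I_n} => [ffun i => i \in S]) => [f|S] _.
    by apply/ffunP => i; rewrite ffunE inE.
  by apply/setP => i; rewrite inE ffunE.
apply: eq_bigr => f _; rewrite malg_scaler_prod /=.
rewrite [X in _ = _ *: X](eq_bigr (fun i => ab_var (if i \in [set i | f i] then Lb else La)));
  last by move=> i _; rewrite inE.
case: ifPn => [sUS|/subsetPn[i iU]]; last first.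
  rewrite inE => fi; rewrite (bigD1 i) //= (negPf fi) iU.
  by rewrite mul0r scale0r.
apply: (congr1 (fun z => z *: _)); rewrite -cardsDS //.
rewrite (eq_bigr (fun i => if i \in [set i | f i] :\: U then -1 else 1)).
  by rewrite -big_mkcond /= prodr_const.
move=> i _; rewrite !inE; case: ifP => fi; case: ifP => iU //=.
by move/subsetP/(_ _ iU): sUS; rewrite inE fi.
Qed.

Lemma ab_index_chain_sum {d : Order.disp_t} {T : finTBPOrderType d}
    (rho : T -> nat) n :
  graded rho -> rho \top%O = n.+1 ->
  ab_index rho n = chain_sum rho vb ve \top%O.
Proof.
move=> rho_graded rank_top; rewrite /ab_index /flag_h.
transitivity (\sum_(U : {set 'I_n}) (flag_f rho U)%:R *:
    \prod_(i < n) (if i \in U then vb else ve)).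
  under [RHS]eq_bigr => U _ do rewrite -prod_ab_sum_superset scaler_sumr.
  rewrite [RHS](exchange_big_dep predT) //=; apply: eq_bigr => S _.
  rewrite rmorph_sum /= scaler_suml; apply: eq_bigr => U _.
  rewrite scalerA; apply: (congr1 (fun z => z *: _)).
  by rewrite rmorphM rmorphXn rmorphN1 /= mulrC -pmulrn.
rewrite /chain_sum rank_top /= (partition_big (@rank_set _ _ rho n) predT) //=.
apply: eq_bigr => U _; rewrite (flag_f_chains rho_graded) // -sum1_card natr_sum scaler_suml.
apply: eq_big => [C|C]; rewrite inE //= => /andP[_ /eqP <-]; rewrite scale1r.
by apply: eq_bigr => i _; rewrite inE.
Qed.

(** * Existence of the cd-index *)

(** Here 1 + K is zeta, D is the diagonal sign (-1)^rho and Y = (zeta+1)^-1. Conjugation by D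
    inverts zeta, and N = 2 (zeta-1) (zeta+1)^-1 changes sign when zeta is inverted. *)
Lemma double_zeta_inverse (R : pzRingType) (K D Y : R) :
    D * D = 1 -> D * (1 + K) * D * (1 + K) = 1 ->
    (2 + K) * Y = 1 -> Y * (2 + K) = 1 ->
  let N := 2 * K * Y in D * N * D = - N /\ 2 * N + K * N = 2 * K.
Proof.
move=> DD DKDK BY YB N.
have KY : K * Y = Y * K.
  have BK : (2 + K) * K = K * (2 + K).
    by rewrite mulrDl mulrDr mulr_natl mulr_natr.
  have := congr1 (fun z => Y * z * Y) BK.
  by rewrite mulrA YB mul1r -!mulrA BY mulr1.
have NB : N * (2 + K) = 2 * K by rewrite -mulrA YB mulr1.
split; last first.
  have -> : N = Y * (2 * K) by rewrite /N !mulr_natl mulrnAr mulrnAl KY.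
  by rewrite -mulrDl mulrA BY mul1r.
have KD x y : D * (x * y) * D = (D * x * D) * (D * y * D).
  by rewrite !mulrA -[D * x * D * D]mulrA DD mulr1.
have D2 : D * 2 * D = 2 by rewrite mulr_natr mulrnAl DD.
have DBK : (D * (2 + K) * D) * (1 + K) = 2 + K.
  have -> : D * (2 + K) * D = 1 + D * (1 + K) * D.
    by rewrite -[2]/(1 + 1) -addrA mulrDr mulr1 mulrDl DD.
  by rewrite mulrDl mul1r DKDK addrC addrA.
(* The claim is checked after multiplication by the invertible zeta + 1, where both sides are
   -2K. *)
have NDB : D * N * D * (2 + K) = - N * (2 + K).
  rewrite -{1}DBK [_ * (_ * (1 + K))]mulrA -KD NB KD D2.
  have -> : D * K * D = D * (1 + K) * D - 1.
    by rewrite mulrDr mulr1 mulrDl DD [1 + _]addrC addrK.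
  rewrite -mulrA mulrBl DKDK mul1r opprD addrA subrr add0r mulrN mulNr.
  by rewrite NB.
by rewrite -[LHS]mulr1 -[RHS]mulr1 -BY [LHS]mulrA NDB mulrA.
Qed.

Section EulerianKernel.
Context {d : Order.disp_t} {T : finTBPOrderType d}.
Variables (rho : T -> nat) (rho_graded : graded rho) (rho_eulerian : eulerian rho).

Lemma sum_enum_val (V : nmodType) (F : T -> V) :
  \sum_(i < #|T|) F (enum_val i) = \sum_z F z.
Proof.
rewrite [RHS](reindex (@enum_val T T)) //=.
by apply: onW_bij; apply: enum_val_bij.
Qed.

Let K : 'M[rat]_#|T| := \matrix_(i, j) (enum_val i < enum_val j)%O%:R.
Let D : 'M[rat]_#|T| := \matrix_(i, j) ((-1) ^+ rho (enum_val i) *+ (i == j)).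

(** Ordered by rank, zeta + 1 is triangular with diagonal 2; concretely, a vector killed by it
    vanishes by induction on the rank. *)
Lemma double_zeta_unit : 2 + K \in unitmx.
Proof.
rewrite -row_free_unit; apply/row_freeP/row_freeP/inj_row_free => v vB.
pose w t := v 0 (enum_rank t).
have wE t : w t *+ 2 = - \sum_(s | (s < t)%O) w s.
  have := congr1 (fun u : 'rV_#|T| => u 0 (enum_rank t)) vB.
  rewrite mulmxDr -[2]/(1 + 1) mulmxDr mulmx1 !mxE.
  under eq_bigr => i _ do rewrite mxE enum_rankK.
  move/eqP; rewrite addr_eq0 -mulr2n => /eqP ->; congr (- _).
  rewrite [RHS]big_mkcond -[RHS]sum_enum_val; apply: eq_bigr => i _.
  by rewrite /w enum_valK; case: ifP; rewrite (mulr1, mulr0).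
have w0 t : w t = 0.
  have [m le_m] := ubnP (rho t); elim: m t le_m => // m IH t le_m.
  apply/eqP; move/eqP: (wE t); rewrite big1 ?oppr0 ?mulrn_eq0 // => s st.
  by apply: IH; apply: leq_trans (rank_lt rho_graded st) _; rewrite -ltnS.
by apply/rowP => i; rewrite mxE -[i]enum_valK; apply: w0.
Qed.

(** [nu] is the matrix N of [double_zeta_inverse]. The first identity is (zeta+1) nu = 2 (zeta-1);
    by the sign change under D, an entry between ranks of equal parity is its own opposite. *)
Lemma eulerian_kernel : exists nu : T -> T -> rat,
  [/\ forall s t, (s < t)%O%:R = nu s t + 2^-1 * \sum_(z | (s < z)%O) nu z t,
      forall s t, ~~ odd (rho s + rho t) -> nu s t = 0
    & forall s t, ~~ (s < t)%O -> nu s t = 0].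
Proof.
have DD : D * D = 1.
  apply/matrixP => i j; rewrite !mxE (bigD1 i) //= big1 => [|k ki].
    by rewrite addr0 !mxE eqxx mulr1n mulrnAr -expr2 sqrr_sign.
  by rewrite !mxE [i == k]eq_sym (negPf ki) mul0r.
have DM (A : 'M[rat]_#|T|) i j : (D * A) i j = (-1) ^+ rho (enum_val i) * A i j.
  rewrite mxE (bigD1 i) //= big1 => [|k ki].
    by rewrite addr0 mxE eqxx mulr1n.
  by rewrite mxE eq_sym (negPf ki) mul0r.
have MD (A : 'M[rat]_#|T|) i j : (A * D) i j = A i j * (-1) ^+ rho (enum_val j).
  rewrite mxE (bigD1 j) //= big1 => [|k kj].
    by rewrite addr0 mxE eqxx mulr1n.
  by rewrite mxE (negPf kj) mulr0.
(* This is the Eulerian condition: up to sign, the entry at s < t is the alternating sum over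
   [s,t]. *)
have DKDK : D * (1 + K) * D * (1 + K) = 1.
  have KE i j : (1 + K) i j = (enum_val i <= enum_val j)%O%:R.
    rewrite !mxE le_eqVlt (inj_eq enum_val_inj).
    by case: eqP => [->|_]; rewrite ?ltxx ?addr0 ?add0r.
  apply/matrixP => i j; rewrite -!mulrA DM mxE.
  under eq_bigr => k _ do rewrite DM !KE.
  rewrite (sum_enum_val (fun z => (enum_val i <= z)%O%:R *
     ((-1) ^+ rho z * (z <= enum_val j)%O%:R))).
  transitivity ((-1) ^+ rho (enum_val i) *
     \sum_(z | (enum_val i <= z <= enum_val j)%O) (-1) ^+ rho z : rat).
    congr (_ * _); rewrite [RHS]big_mkcond; apply: eq_bigr => z _.
    by do 2!case: (_ <= _)%O; rewrite ?mul0r ?mul1r ?mulr1 ?mulr0.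
  have [lt_ij|nlt] := boolP (enum_val i < enum_val j)%O.
    have sum0 := rho_eulerian lt_ij.
    rewrite (_ : \sum_(z | _) _ = (\sum_(z | (enum_val i <= z <= enum_val j)%O)
       (-1) ^+ rho z : int)%:~R); last first.
      by rewrite rmorph_sum; apply: eq_bigr => z _; rewrite rmorphXn /= rmorphN1.
    rewrite sum0 mulr0 mxE; case: eqP => // eq_ij.
    by move: lt_ij; rewrite eq_ij ltxx.
  rewrite mxE; have [<-|ne_ij] := eqVneq i j.
    rewrite (big_pred1 (enum_val i)) => [|z]; last by rewrite /= eq_sym eq_le andbC.
    by rewrite -expr2 sqrr_sign.
  rewrite big_pred0 ?mulr0 // => z; apply: contraNF nlt => /andP[iz zj].
  by rewrite lt_neqAle (le_trans iz zj) (inj_eq enum_val_inj) ne_ij.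
have BY := mulmxV double_zeta_unit; have YB := mulVmx double_zeta_unit.
have [ND NK] := double_zeta_inverse DD DKDK BY YB.
set N := 2 * K * _ in ND NK.
pose nu s t := N (enum_rank s) (enum_rank t).
have nuE s t : (s < t)%O%:R = nu s t + 2^-1 * \sum_(z | (s < z)%O) nu z t.
  have := congr1 (fun A : 'M[rat]_#|T| => A (enum_rank s) (enum_rank t)) NK.
  rewrite !mulr_natl mxE mulmxnE [RHS]mulmxnE [K _ _]mxE !enum_rankK -/(nu s t).
  rewrite mxE (_ : \sum_j _ = \sum_(z | (s < z)%O) nu z t) => [eqN|].
    by rewrite -[LHS](mulKf (x := 2)) // mulr_natl -eqN; field.
  rewrite [RHS]big_mkcond -[RHS]sum_enum_val; apply: eq_bigr => k _.
  rewrite mxE enum_rankK /nu enum_valK.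
  by case: ifP; rewrite ?mul1r ?mul0r.
exists nu; split=> // s t => [even_st|].
  have := congr1 (fun A : 'M[rat]_#|T| => A (enum_rank s) (enum_rank t)) ND.
  rewrite MD DM [(- N) _ _]mxE -/(nu s t) !enum_rankK mulrAC -exprD -signr_odd (negPf even_st).
  rewrite expr0 mul1r; lra.
(* Downward induction on s: the identity reduces [nu s t] to the [nu z t] with s < z, and z < t
   would force s < t. *)
have [m le_m] := ubnP (rho \top%O - rho s).
elim: m s le_m => // m IH s le_m nst.
have := nuE s t; rewrite (negPf nst) big1 ?mulr0 ?addr0 // => z sz.
have [zt|nzt] := boolP (z < t)%O; first by rewrite (lt_trans sz zt) in nst.
have ltr := rank_lt rho_graded sz.
apply: IH => //; rewrite -ltnS; apply: leq_trans le_m.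
by rewrite ltnS ltn_sub2l // (leq_trans ltr) // rank_le // lex1.
Qed.

End EulerianKernel.

Lemma sqrrB_comm_defect (A : pzRingType) (a b : A) :
  (a - b) ^+ 2 = (a + b) * (a + b) - (a * b + b * a) *+ 2.
Proof.
rewrite expr2 mulrBl !mulrBr mulrDl !mulrDr mulr2n !opprD opprK !addrA.
by rewrite [RHS](ACl (1*5*6*4*(2*7)*(3*8))%AC) /= !subrr !addr0.
Qed.

Section ChainSumKernel.
Context {d : Order.disp_t} {T : finTBPOrderType d}.
Variables (rho : T -> nat) (rho_graded : graded rho).
Variables (R : numFieldType) (A : lalgType R) (b e : A).
Variable nu : T -> T -> R.
Hypothesis nuE : forall s t, (s < t)%O%:R = nu s t + 2^-1 * \sum_(z | (s < z)%O) nu z t.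
Hypothesis nu0 : forall s t, ~~ (s < t)%O -> nu s t = 0.

(** Substitute zeta - 1 = nu + (zeta-1) nu / 2 for the relation s < t in [chain_sum_rec]. The second
    term reassembles Psi(z) e / 2, which joins the Psi(z) b of the first; for e = a - b, the factor
    e + 2b is c. *)
Lemma chain_sum_kernel t : t != \bot%O ->
  chain_sum rho b e t =
  \sum_(s | (s < t)%O) nu s t *:
     ((if s == \bot%O then 1 else 2^-1 *: (chain_sum rho b e s * (e + b *+ 2))) *
      e ^+ (rho t - 1 - rho s)).
Proof.
(* The values of [B] and [P] at [\bot] are chosen so that [PE] holds at every element. *)
pose B s := if s == \bot%O then 1 else chain_sum rho b e s * b.
pose P s := if s == \bot%O then 0 else chain_sum rho b e s.
pose E s u := e ^+ (rho u - 1 - rho s).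
have PE u : P u = \sum_(s | (s < u)%O) B s * E s u.
  rewrite /P; have [->|u0] := eqVneq u \bot%O.
    by rewrite big_pred0 // => s; rewrite ltx0.
  rewrite chain_sum_rec // [RHS](bigD1 \bot%O) ?lt0x //= {1}/B eqxx mul1r /E.
  rewrite rho_graded.1 subn0 subn1; congr (_ + _).
  apply: eq_big => s; first by rewrite lt0x andbC.
  by rewrite lt0x => /andP[s0 _]; rewrite /B (negPf s0).
move=> t0; have -> : chain_sum rho b e t = P t by rewrite /P (negPf t0).
transitivity (\sum_s nu s t *: (B s * E s t) +
    \sum_z nu z t *: ((2^-1 *: (P z * e)) * E z t)).
  rewrite [LHS]PE big_mkcond /=.
  transitivity (\sum_s (nu s t + 2^-1 * \sum_(z | (s < z)%O) nu z t) *: (B s * E s t)).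
    apply: eq_bigr => s _; have := nuE s t; case: ifP => _ <-.
      by rewrite [RHS]scale1r.
    by rewrite [RHS]scale0r.
  rewrite (eq_bigr _ (fun s _ => scalerDl _ _ _)).
  rewrite big_split /=; congr (_ + _).
  under eq_bigr => s _ do rewrite mulr_sumr scaler_suml.
  rewrite (exchange_big_dep predT) //=; apply: eq_bigr => z _.
  have [zt|nzt] := boolP (z < t)%O; last first.
    by rewrite nu0 // scale0r big1 // => s _; rewrite mulr0 scale0r.
  under eq_bigr => s _ do rewrite mulrC -scalerA.
  rewrite -scaler_sumr -scaler_sumr -!scalerAl PE !mulr_suml.
  congr (_ *: (_ *: _)); apply: eq_bigr => s sz.
  (* The powers of e on both sides of z combine, one more e filling the rank of z. *)
  rewrite -!mulrA /E -exprS -exprD; congr (_ * (_ ^+ _)).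
  by have := rank_lt rho_graded sz; have := rank_lt rho_graded zt; lia.
rewrite -big_split [RHS]big_mkcond /=; apply: eq_bigr => s _.
case: ifPn => [st|/nu0->]; last by rewrite !scale0r addr0.
rewrite -scalerDr -mulrDl /B /P; congr (_ *: (_ * _)).
case: eqP => _; first by rewrite mul0r scaler0 addr0.
rewrite mulrDr scalerDr addrC mulrnAr -[(_ * _) *+ 2]scaler_nat scalerA mulVf ?pnatr_eq0 //.
by rewrite scale1r.
Qed.

End ChainSumKernel.

Section CdSubst.
Local Notation va := (ab_var La).
Local Notation vb := (ab_var Lb).
Local Notation ve := (va - vb).

Definition cd_generated (p : ab_poly) := exists Phi : cd_poly, cd_subst Phi = p.

Lemma cd_substU c (w : {fmonom cd_letter}) :
  cd_subst << c *g w >> = c *: \prod_(l <- (w : seq _)) cd_value l.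
Proof. by rewrite -mul_malgC; apply: mmapU. Qed.

Lemma cd_generated0 : cd_generated 0.
Proof. by exists 0; apply: mmap0. Qed.

Lemma cd_generatedD p q : cd_generated p -> cd_generated q -> cd_generated (p + q).
Proof. by case=> [P <-] [Q <-]; exists (P + Q); apply: mmapD. Qed.

Lemma cd_substE (Phi : cd_poly) :
  cd_subst Phi = \sum_(w <- msupp Phi) Phi@_w *: \prod_(l <- (w : seq _)) cd_value l.
Proof.
rewrite /cd_subst /mmap; apply: eq_bigr => w _; exact: mul_malgC.
Qed.

Lemma cd_generatedZ c p : cd_generated p -> cd_generated (c *: p).
Proof.
case=> P <-; rewrite cd_substE scaler_sumr.
elim/big_rec: _ => [|w q _ IH]; first exact: cd_generated0.
apply: cd_generatedD IH; exists << c * P@_w *g w >>.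
by rewrite cd_substU scalerA.
Qed.

Lemma cd_generatedM p l : cd_generated p -> cd_generated (p * cd_value l).
Proof.
case=> P <-; rewrite cd_substE big_distrl.
elim/big_rec: _ => [|w q _ IH]; first exact: cd_generated0.
apply: cd_generatedD IH; exists << P@_w *g FMonom (rcons w l) >>.
rewrite cd_substU /= -cats1 big_cat /= big_seq1.
exact: scalerAl.
Qed.

Lemma cd_generated1 : cd_generated 1.
Proof. by exists << 1 *g FMonom [::] >>; rewrite cd_substU big_nil scale1r. Qed.

Lemma sqr_ab_diff : ve ^+ 2 = cd_value Lc * cd_value Lc - cd_value Ld *+ 2.
Proof. exact: sqrrB_comm_defect. Qed.

Lemma cd_generated_even p k : cd_generated p -> cd_generated (p * ve ^+ (k.*2)).
Proof.
move=> cdp; elim: k => [|k IH]; first by rewrite expr0 mulr1.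
rewrite doubleS -addn2 exprD mulrA sqr_ab_diff mulrBr mulrA.
set q : ab_poly := p * _ in IH *.
rewrite mulrnAr -scaleN1r -[(q * _) *+ 2]scaler_nat.
apply: cd_generatedD; first by apply/cd_generatedM/cd_generatedM.
by do 2!apply: cd_generatedZ; apply: cd_generatedM.
Qed.

(** Induction on the rank through [chain_sum_kernel]: as [nu] lives on pairs with odd rank
    difference, e occurs to even powers only, and e^2 = c^2 - 2d. *)
Lemma chain_sum_cd_generated {d : Order.disp_t} {T : finTBPOrderType d}
    (rho : T -> nat) (t : T) :
  graded rho -> eulerian rho -> t != \bot%O ->
  cd_generated (chain_sum rho vb ve t).
Proof.
move=> rho_graded rho_eulerian.
have [nu [nuE nu_even nu0]] := eulerian_kernel rho_graded rho_eulerian.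
have [m le_m] := ubnP (rho t); elim: m t le_m => // m IH t le_m t0.
rewrite (chain_sum_kernel rho_graded _ _ nuE nu0 t0).
elim/big_rec: _ => [|s q st cdq]; first exact: cd_generated0.
apply: cd_generatedD cdq; have lt_r := rank_lt rho_graded st.
have [odd_st|/nu_even->] := boolP (odd (rho s + rho t)); last first.
  by rewrite scale0r; apply: cd_generated0.
apply: cd_generatedZ.
have -> : (rho t - 1 - rho s = ((rho t - 1 - rho s)./2).*2)%N by lia.
apply: cd_generated_even; case: ifPn => [_|s0]; first exact: cd_generated1.
apply: cd_generatedZ.
have -> : ve + vb *+ 2 = cd_value Lc by rewrite mulr2n addrA subrK.
by apply/cd_generatedM/IH => //; apply: leq_trans lt_r _; rewrite -ltnS.
Qed.

(** The description satisfies its equation once a solution exists, and [chain_sum_cd_generated]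
    provides one. *)
Lemma cd_index_subst {d : Order.disp_t} {T : finTBPOrderType d}
    (rho : T -> nat) n :
  graded rho -> eulerian rho -> rho \top%O = n.+1 ->
  cd_subst (cd_index rho n) = chain_sum rho vb ve \top%O.
Proof.
move=> rho_graded rho_eulerian rank_top.
rewrite -(ab_index_chain_sum rho_graded rank_top).
apply: (epsilon_spec (inhabits 0) (fun Phi => cd_subst Phi = ab_index rho n)).
rewrite (ab_index_chain_sum rho_graded rank_top).
apply: chain_sum_cd_generated => //.
by rewrite -(rank_gt0 rho_graded) rank_top.
Qed.

End CdSubst.

(** * The toric polynomial as a functional of the ab-index *)

Section ToricFunctional.
Local Notation va := (ab_var La).
Local Notation vb := (ab_var Lb).
Local Notation ve := (va - vb).

Lemma coef_toric_truncate r (f : {poly rat}) i :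
  (toric_truncate r f)`_i = if (i <= (r.-1)./2)%N then f`_i - (f * 'X)`_i else 0.
Proof.
rewrite /toric_truncate -(poly_def _ (fun i => f`_i - (if i is j.+1 then f`_j else 0))).
by rewrite coef_poly ltnS coefMX; case: i.
Qed.

Lemma toric_truncate_is_linear r : linear (toric_truncate r).
Proof.
move=> c p q; apply/polyP => i.
rewrite coefD coefZ !coef_toric_truncate; case: ifP => _; last by rewrite mulr0 addr0.
by rewrite mulrDl -scalerAl !coefD !coefZ; ring.
Qed.

HB.instance Definition _ r := GRing.isLinear.Build rat {poly rat} {poly rat} _
  (toric_truncate r) (@toric_truncate_is_linear r).

(* The recursion consumes letters from the end of the word, so it runs on the   *)
(* reversed word.                                                               *)
Fixpoint toric_rev_word (w : seq ab_letter) : {poly rat} :=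
  if w is l :: w' then
    let f := toric_rev_word w' in
    let g := toric_truncate (size w').+1 f in
    if l is La then ('X - 1) * f + g else g
  else 1.

(* Vanishing on words of length other than n makes the recursion valid for all  *)
(* ab-polynomials, homogeneous or not.                                          *)
Definition toric_word n (w : {fmonom ab_letter}) : {poly rat} :=
  if size w == n then toric_rev_word (rev w) else 0.

Definition toric_ab n (p : ab_poly) : {poly rat} := mmap polyC (toric_word n) p.

HB.instance Definition _ n := GRing.Additive.copy (toric_ab n) (mmap polyC (toric_word n)).

Lemma toric_abU n c w : toric_ab n << c *g w >> = c *: toric_word n w.
Proof. by rewrite -mul_polyC; apply: mmapU. Qed.

Lemma toric_abZ n c p : toric_ab n (c *: p) = c *: toric_ab n p.
Proof.
rewrite /toric_ab (mmapEw (msuppZ_le c p)) mmapE scaler_sumr.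
by apply: eq_bigr => w _; rewrite mcoeffZ -!mul_polyC mulrA -polyCM.
Qed.

Lemma toric_ab_var n p l (L : {linear {poly rat} -> {poly rat}}) :
    (forall w : {fmonom ab_letter},
      toric_word n (FMonom (w ++ [:: l])) = L (toric_word n.-1 w)) ->
  toric_ab n (p * ab_var l) = L (toric_ab n.-1 p).
Proof.
move=> H; rewrite [in LHS](monalgE p) [in RHS](monalgE p) mulr_suml.
rewrite (raddf_sum (toric_ab n)) (raddf_sum (toric_ab n.-1)) (raddf_sum L).
apply: eq_bigr => w _; rewrite /= malgUM mulr1 !toric_abU (linearZZ L) -H.
by rewrite (_ : mmul w _ = FMonom (w ++ [:: l])) //; apply: fmmulE.
Qed.

Lemma toric_word_rcons n (w : {fmonom ab_letter}) l :
  toric_word n.+1 (FMonom (w ++ [:: l])) =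
  let f := toric_word n w in let g := toric_truncate n.+1 f in
  if l is La then ('X - 1) * f + g else g.
Proof.
rewrite /toric_word size_cat addn1 eqSS rev_cat /= size_rev.
case: eqP => [->//|_]; by case: l; rewrite ?mulr0 ?linear0 ?addr0.
Qed.

Lemma toric_abMb n p : toric_ab n.+1 (p * vb) = toric_truncate n.+1 (toric_ab n p).
Proof. by apply: (toric_ab_var _ (L := toric_truncate n.+1)) => w; apply: toric_word_rcons. Qed.

Lemma toric_abMa n p : toric_ab n.+1 (p * va) =
  ('X - 1) * toric_ab n p + toric_truncate n.+1 (toric_ab n p).
Proof.
apply: (toric_ab_var p (L := ('X - 1) \*o idfun \+ toric_truncate n.+1)) => w.
exact: toric_word_rcons.
Qed.

(** The truncations in the rules for a and b cancel. *)
Lemma toric_abMe n p : toric_ab n.+1 (p * ve) = ('X - 1) * toric_ab n p.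
Proof.
transitivity (toric_ab n.+1 (p * va) - toric_ab n.+1 (p * vb)).
  by rewrite mulrBr; apply: raddfB.
exact: etrans (congr2 (fun x y => x - y) (toric_abMa n p) (toric_abMb n p)) (addrK _ _).
Qed.

Lemma toric_ab0M p l : toric_ab 0 (p * ab_var l) = 0.
Proof.
apply: (toric_ab_var _ (L := \0)) => w.
by rewrite /toric_word size_cat addn1.
Qed.

Lemma toric_ab1 n : toric_ab n 1 = (n == 0)%:R.
Proof. by rewrite [LHS]toric_abU scale1r /toric_word !fm1 eq_sym; case: n. Qed.

Lemma toric_abMeX m k p :
  toric_ab (m + k)%N (p * ve ^+ k) = ('X - 1) ^+ k * toric_ab m p.
Proof.
elim: k => [|k IH]; first by rewrite addn0 !expr0 mul1r mulr1.
by rewrite addnS exprSr mulrA toric_abMe IH exprS mulrA.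
Qed.

(** Apply the functional to [chain_sum_rec]: Psi(s) b e^k goes to (x-1)^k g([0,s)), the summand of s
    in f, and the pure power of e goes to the summand of [\bot]. *)
Lemma toric_f_chain_sum {d : Order.disp_t} {T : finTBPOrderType d}
    (rho : T -> nat) (t : T) : graded rho -> t != \bot%O ->
  toric_f rho t = toric_ab (rho t).-1 (chain_sum rho vb ve t).
Proof.
move=> rho_graded.
have [m le_m] := ubnP (rho t); elim: m t le_m => // m IH t le_m t0.
rewrite /toric_f (negPf t0) chain_sum_rec // (raddfD (toric_ab _)) (raddf_sum (toric_ab _)).
rewrite (bigD1 \bot%O) ?lt0x //= toric_g_bot rho_graded.1 subn0 subn1 mul1r.
congr (_ + _).
  by rewrite -[_ ^+ _ in RHS]mul1r -[X in toric_ab X]add0n toric_abMeX toric_ab1 mulr1.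
apply: eq_big => s; first by rewrite lt0x andbC.
case/andP=> st s0; have ltr := rank_lt rho_graded st.
have rs : (0 < rho s)%N by rewrite rank_gt0.
(* Psi(s) b has degree [rho s]; the remaining k letters are e. *)
have : (rho t).-1 = (rho s + ((rho t).-1 - rho s))%N by lia.
move: ((rho t).-1 - rho s)%N => k ->.
transitivity (('X - 1) ^+ k * toric_ab (rho s) (chain_sum rho vb ve s * vb)).
  rewrite mulrC; apply: (congr1 (fun z => ('X - 1) ^+ k * z)).
  rewrite toric_gE // IH //; last by apply: leq_trans ltr _; rewrite -ltnS.
  rewrite -{3}(prednK rs).
  exact: etrans (esym (toric_abMb _ _)) _.
exact: esym (toric_abMeX _ _ _).
Qed.

End ToricFunctional.

(** * Effect of appending c or d on coefficients *)

Section ToricSteps.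
Implicit Types (F : {poly rat}) (n i k : nat).

(** For F = L(u) with u of degree n, this is L(u c) = L(u a) + L(u b); the next definition is L(u d)
    = L(u ab) + L(u ba). *)
Definition toric_step_c n F : {poly rat} :=
  ('X - 1) * F + toric_truncate n.+1 F *+ 2.

Definition toric_step_d n F : {poly rat} :=
  toric_truncate n.+2 (toric_step_c n F) + ('X - 1) * toric_truncate n.+1 F.

(** The second branch also bounds the degree by n. *)
Definition palindromic n F := forall i, F`_i = if (i <= n)%N then F`_(n - i) else 0.

Lemma coefX1M F i : (('X - 1) * F)`_i = (F * 'X)`_i - F`_i.
Proof. by rewrite mulrBl mul1r coefB commr_polyX. Qed.

Lemma coef_step_c n F i : (toric_step_c n F)`_i =
  if (i <= n./2)%N then F`_i - (F * 'X)`_i else (F * 'X)`_i - F`_i.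
Proof.
rewrite /toric_step_c coefD coefX1M coefMn coef_toric_truncate /=.
by case: ifP => _; ring.
Qed.

Lemma coef_step_c_high n F i : palindromic n F -> (n./2 < i <= n.+1)%N ->
  (toric_step_c n F)`_i = F`_(n.+1 - i) - (F * 'X)`_(n.+1 - i).
Proof.
move=> palF /andP[ni iN]; rewrite coef_step_c leqNgt ni /= !coefMX.
have -> : (i == 0)%N = false by lia.
have -> : F`_i.-1 = F`_(n.+1 - i).
  by rewrite palF; have -> : (i.-1 <= n)%N by [lia]; congr (F`_ _); lia.
congr (_ - _); rewrite palF; case: (leqP i n) => le_in.
  have -> : (n.+1 - i == 0)%N = false by lia.
  by congr (F`_ _); lia.
by have -> : (n.+1 - i == 0)%N by lia.
Qed.

Lemma palindromic_step_c n F :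
  palindromic n F -> palindromic n.+1 (toric_step_c n F).
Proof.
move=> palF i; case: ifPn => [le_in|]; last first.
  rewrite -ltnNge => lt_ni; rewrite coef_step_c coefMX (palF i) (palF i.-1).
  have -> : (i <= n./2)%N = false by lia.
  have -> : (i <= n)%N = false by lia.
  have -> : (i == 0)%N = false by lia.
  by have -> : (i.-1 <= n)%N = false by [lia]; rewrite subr0.
have low j : (j <= n./2)%N -> (toric_step_c n F)`_j = (toric_step_c n F)`_(n.+1 - j).
  move=> jn; rewrite [RHS]coef_step_c_high //; last by lia.
  by rewrite coef_step_c jn subKn //; lia.
case: (leqP i n./2) => [|ni]; first exact: low.
case: (leqP (n.+1 - i) n./2) => [/low->|nj]; first by rewrite subKn.
by congr (_`_ _); lia.
Qed.

(** With g_i = F_i - F_(i-1), the truncation of [toric_step_c] gives g_i - g_(i-1) and (x-1) g gives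
    the opposite. Only the top term x g_i of the latter survives, and only for even n. *)
Lemma coef_step_d n F i : palindromic n F ->
  (toric_step_d n F)`_i =
  if ~~ odd n && (i == n./2.+1) then F`_n./2 - (F * 'X)`_n./2 else 0.
Proof.
move=> palF; rewrite /toric_step_d coefD coefX1M !coef_toric_truncate /=.
rewrite [(toric_truncate _ _ * _)`_i]coefMX !coef_toric_truncate /= coefMX !coef_step_c.
(* For odd n the two middle coefficients of F coincide. *)
have mid : odd n -> F`_((n.+1)./2) - (F * 'X)`_((n.+1)./2) = 0.
  move=> oddn; rewrite coefMX.
  have -> : (n.+1./2 == 0)%N = false by lia.
  rewrite palF; have -> : ((n.+1)./2 <= n)%N by lia.
  by have -> : (n - n.+1./2 = n.+1./2.-1)%N by [lia]; rewrite subrr.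
case: (posnP i) => [->|i_gt0].
  by rewrite /= andbF coefMX /=; ring.
case: (leqP i (n.+1)./2) => lei.
  have -> : (i.-1 <= n./2)%N by lia.
  have -> : ~~ odd n && (i == n./2.+1) = false by lia.
  case: (leqP i n./2) => lein; first by ring.
  have [oddn ei] : odd n /\ i = n.+1./2 by split; lia.
  by rewrite -[_ - F`_i]opprB ei mid //; ring.
have -> : (i <= n./2)%N = false by lia.
case: (boolP (odd n)) => oddn /=.
  by have -> : (i.-1 <= n./2)%N = false by [lia]; ring.
case: eqP => [->|ne] /=; first by rewrite leqnn; ring.
by have -> : (i.-1 <= n./2)%N = false by [lia]; ring.
Qed.

Lemma palindromic_step_d n F :
  palindromic n F -> palindromic n.+2 (toric_step_d n F).
Proof.
move=> palF i; rewrite !coef_step_d //; case: (leqP i n.+2) => le_in.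
  by have -> : ~~ odd n && (n.+2 - i == n./2.+1)%N = ~~ odd n && (i == n./2.+1) by lia.
by have -> : ~~ odd n && (i == n./2.+1) = false by lia.
Qed.

(** The coefficient of x^k in x^n F(x^-2). *)
Definition short_coef n F k : rat :=
  if (k <= n)%N && ~~ odd (n - k) then F`_((n - k)./2) else 0.

(** Lowering the index of F by one raises k by two, so F_i - F_(i-1) becomes a difference of short
    coefficients at distance two. At k = 0 the equal middle coefficients cancel. *)
Lemma short_coef_step_c n F k : palindromic n F ->
  short_coef n.+1 (toric_step_c n F) k =
  if k is k'.+1 then short_coef n F k' - short_coef n F k.+1 else 0.
Proof.
move=> palF; rewrite /short_coef; case: k => [|k].
  rewrite leq0n subn0 /=; case: ifPn => // /negPn oddn.
  rewrite coef_step_c_high //; last by lia.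
  rewrite (_ : n.+1 - _ = n.+1./2)%N; last by lia.
  rewrite coefMX (_ : (n.+1./2 == 0)%N = false); last by lia.
  rewrite palF (_ : (n.+1./2 <= n)%N); last by lia.
  by rewrite (_ : n - _ = n.+1./2.-1)%N ?subrr //; lia.
rewrite subSS ltnS; case: (leqP k n) => [le_kn|lt_nk] /=; last first.
  by rewrite (_ : (k.+1 < n)%N = false) ?subr0 //; lia.
case: (boolP (odd (n - k))) => [odd_nk|even_nk] /=.
  by rewrite (_ : (_ && _) = false) ?subr0 //; lia.
rewrite coef_step_c (_ : ((n - k)./2 <= n./2)%N); last by lia.
congr (_ - _); rewrite coefMX.
have [lt_kn|ge_kn] := ltnP k.+1 n.
  rewrite (_ : ((n - k)./2 == 0)%N = false); last by lia.
  by rewrite (_ : ~~ _); [congr (_`_ _)|]; lia.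
by rewrite (_ : ((n - k)./2 == 0)%N) //; lia.
Qed.

(** The single monomial found in [coef_step_d] has the middle degree, which corresponds to k = 0. *)
Lemma short_coef_step_d n F k : palindromic n F ->
  short_coef n.+2 (toric_step_d n F) k =
  if k == 0%N then short_coef n F 0 - short_coef n F 2 else 0.
Proof.
move=> palF; rewrite /short_coef coef_step_d // !subn0 !leq0n /=.
case: (eqVneq k 0%N) => [->|k0].
  rewrite subn0 /= eqxx andbT negbK; case: (boolP (odd n)) => oddn /=.
    by rewrite (_ : (_ && _) = false) ?subr0 //; lia.
  congr (_ - _); rewrite coefMX.
  have [n2|n2] := leqP 2 n; last by rewrite (_ : (n./2 == 0)%N) //; lia.
  rewrite (_ : ~~ odd (n - 2)) /=; last by lia.
  rewrite (_ : (n./2 == 0)%N = false); last by lia.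
  by congr (_`_ _); lia.
case: ifP => // /andP[le_kn even_nk].
by rewrite (_ : ~~ odd n && _ = false) //; lia.
Qed.

End ToricSteps.

(** * The functional on cd-words and sign sequences *)

Section CdWords.
Local Notation va := (ab_var La).
Local Notation vb := (ab_var Lb).
Implicit Types (w : seq cd_letter).

Definition cd_word_value w : ab_poly := \prod_(l <- w) cd_value l.

Lemma cd_word_value_rcons w l : cd_word_value (rcons w l) = cd_word_value w * cd_value l.
Proof. exact: big_rcons. Qed.

Lemma cd_degree_rcons w l :
  cd_degree (rcons w l) = (cd_degree w + (if l is Lc then 1 else 2))%N.
Proof. by rewrite /cd_degree -cats1 big_cat big_seq1. Qed.

Lemma toric_abMc n p : toric_ab n.+1 (p * cd_value Lc) = toric_step_c n (toric_ab n p).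
Proof.
transitivity (toric_ab n.+1 (p * va) + toric_ab n.+1 (p * vb)).
  by rewrite mulrDr; apply: raddfD.
apply: etrans (congr2 +%R (toric_abMa n p) (toric_abMb n p)) _.
by rewrite -addrA -mulr2n.
Qed.

Lemma toric_ab_d_expand n p : toric_ab n (p * cd_value Ld) =
  toric_ab n (p * va * vb) + toric_ab n (p * vb * va).
Proof.
have Ed : p * cd_value Ld = p * va * vb + p * vb * va.
  exact: etrans (mulrDr p (va * vb) (vb * va)) (congr2 +%R (mulrA _ _ _) (mulrA _ _ _)).
exact: etrans (congr1 (toric_ab n) Ed) (raddfD (toric_ab n) _ _).
Qed.

Lemma toric_abMd n p : toric_ab n.+2 (p * cd_value Ld) = toric_step_d n (toric_ab n p).
Proof.
rewrite toric_ab_d_expand.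
apply: etrans (congr2 +%R (toric_abMb n.+1 (p * va)) (toric_abMa n.+1 (p * vb))) _.
(* The truncations of L(p a) and L(p b) merge into one of L(p c). *)
rewrite addrCA addrC -linearD /=.
apply: etrans (congr2 (fun x y => toric_truncate n.+2 (x + y) + ('X - 1) * y)
  (toric_abMa n p) (toric_abMb n p)) _.
by rewrite -addrA -mulr2n.
Qed.

Lemma toric_ab0_value p l : toric_ab 0 (p * cd_value l) = 0.
Proof.
case: l; last first.
  rewrite toric_ab_d_expand.
  by apply: etrans (congr2 +%R (toric_ab0M _ _) (toric_ab0M _ _)) _; rewrite addr0.
transitivity (toric_ab 0 (p * va) + toric_ab 0 (p * vb)).
  by rewrite mulrDr; apply: raddfD.
by apply: etrans (congr2 +%R (toric_ab0M _ _) (toric_ab0M _ _)) _; rewrite addr0.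
Qed.

Lemma toric_ab1_d p : toric_ab 1 (p * cd_value Ld) = 0.
Proof.
rewrite toric_ab_d_expand.
apply: etrans (congr2 +%R (toric_abMb 0 (p * va)) (toric_abMa 0 (p * vb))) _.
apply: etrans (congr2 (fun x y => toric_truncate 1 x + (('X - 1) * y + toric_truncate 1 y))
  (toric_ab0M p La) (toric_ab0M p Lb)) _.
by rewrite linear0 mulr0 !addr0.
Qed.

Lemma toric_ab_cd_neq n w : n != cd_degree w -> toric_ab n (cd_word_value w) = 0.
Proof.
elim/last_ind: w n => [|w l IH] n.
  by rewrite /cd_degree big_nil /cd_word_value big_nil toric_ab1 => /negPf->.
rewrite cd_degree_rcons cd_word_value_rcons.
case: n => [|n]; first by rewrite toric_ab0_value.
case: l; rewrite ?addn1 ?addn2.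
  by rewrite eqSS => /IH F0; rewrite toric_abMc F0 /toric_step_c mulr0 linear0 mul0rn addr0.
case: n => [|n]; first by rewrite toric_ab1_d.
rewrite !eqSS => /IH F0; rewrite toric_abMd F0 /toric_step_d /toric_step_c.
by rewrite linear0 mul0rn !mulr0 !addr0 linear0.
Qed.

Lemma palindromic_toric_cd w :
  palindromic (cd_degree w) (toric_ab (cd_degree w) (cd_word_value w)).
Proof.
elim/last_ind: w => [|w l IH].
  rewrite /cd_degree big_nil /cd_word_value big_nil toric_ab1 => i.
  by rewrite !coef1 leqn0; case: eqP => [->|].
rewrite cd_degree_rcons cd_word_value_rcons; case: l; rewrite ?addn1 ?addn2.
  by rewrite toric_abMc; apply: palindromic_step_c.
by rewrite toric_abMd; apply: palindromic_step_d.
Qed.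

Lemma size_d_mask w : size (d_mask w) = cd_degree w.
Proof.
rewrite /d_mask /cd_degree size_flatten /shape -map_comp sumnE big_map.
by apply: eq_bigr; case.
Qed.

Lemma d_mask_rcons w l :
  d_mask (rcons w l) = d_mask w ++ (if l is Lc then [:: false] else [:: true; true]).
Proof. by rewrite /d_mask map_rcons flatten_rcons. Qed.

End CdWords.

(** * Sign sequences as lattice paths *)

Section SignPaths.

Definition path_end n (lam : {ffun 'I_n -> bool}) : int := \sum_j sign_val (lam j).

(** The weight at x = 1. *)
Definition path_sign n (lam : {ffun 'I_n -> bool}) : int :=
  (\prod_(i < n) (if lam i then 1 else -1)) * \prod_(i in return_set lam) (-1).

Definition path_valid n w (lam : {ffun 'I_n -> bool}) : bool :=
  (d_positions n w == return_set lam :|: pred_set (return_set lam)) &&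
         [forall i, 0 <= partial_sum lam i].

(** Indexing by natural numbers, with value false from n on, lets sequences of different lengths be
    compared. *)
Definition returns_at n (lam : {ffun 'I_n -> bool}) (i : nat) : bool :=
  [exists j : 'I_n, (j == i :> nat) && (partial_sum lam j == 0)].

Definition path_extend n (lam : {ffun 'I_n -> bool}) (b : bool) : {ffun 'I_n.+1 -> bool} :=
  [ffun i => if unlift ord_max i is Some j then lam j else b].

Lemma widen_lift n (i : 'I_n) : widen_ord (leqnSn n) i = lift ord_max i.
Proof. by apply: ord_inj; rewrite lift_max. Qed.

Lemma path_extend_widen n (lam : {ffun 'I_n -> bool}) b i :
  path_extend lam b (widen_ord (leqnSn n) i) = lam i.
Proof. by rewrite ffunE widen_lift liftK. Qed.

Lemma path_extend_max n (lam : {ffun 'I_n -> bool}) b : path_extend lam b ord_max = b.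
Proof. by rewrite ffunE unlift_none. Qed.

Lemma sum_path_extend n (V : nmodType) (P : pred {ffun 'I_n.+1 -> bool}) F :
  \sum_(lam | P lam) F lam =
  \sum_(lam : {ffun 'I_n -> bool})
    ((if P (path_extend lam true) then F (path_extend lam true) else 0) +
     (if P (path_extend lam false) then F (path_extend lam false) else 0)) :> V.
Proof.
rewrite big_mkcond (reindex (fun p => path_extend p.1 p.2)) /=; last first.
  exists (fun l => ([ffun i => l (widen_ord (leqnSn n) i)], l ord_max)) => [[l b]|l] _ /=.
    congr (_, _); last exact: path_extend_max.
    by apply/ffunP => i; rewrite ffunE path_extend_widen.
  apply/ffunP => i; rewrite ffunE; case: unliftP => [j|] -> //.
  by rewrite ffunE widen_lift.
rewrite -(pair_bigA _ (fun l b => if P (path_extend l b) then F (path_extend l b) else 0)) /=.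
by apply: eq_bigr => l _; rewrite big_bool.
Qed.

Section Extend.
Variables (n : nat) (lam : {ffun 'I_n -> bool}) (b : bool).
Let lam' := path_extend lam b.

Lemma path_end_extend : path_end lam' = path_end lam + sign_val b.
Proof.
rewrite /path_end big_ord_recr /= path_extend_max; congr (_ + _).
by apply: eq_bigr => i _; rewrite path_extend_widen.
Qed.

Lemma partial_sum_extend i : partial_sum lam' (widen_ord (leqnSn n) i) = partial_sum lam i.
Proof.
rewrite /partial_sum big_mkcond big_ord_recr /= leqNgt ltn_ord addr0 [RHS]big_mkcond.
by apply: eq_bigr => j _; rewrite path_extend_widen.
Qed.

Lemma partial_sum_last : partial_sum lam' ord_max = path_end lam + sign_val b.
Proof.
rewrite -path_end_extend /partial_sum; apply: eq_bigl => j.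
by rewrite -ltnS ltn_ord.
Qed.

Lemma returns_at_extend i : returns_at lam' i =
  returns_at lam i || (i == n) && (path_end lam + sign_val b == 0).
Proof.
apply/existsP/orP => [[j /andP[/eqP <-]]|[/existsP[j /andP[/eqP<- pj]]|/andP[/eqP-> p0]]].
- case: (unliftP ord_max j) => [k|] ->.
    rewrite -widen_lift partial_sum_extend => pk; left; apply/existsP.
    by exists k; rewrite eqxx.
  by rewrite partial_sum_last => ->; right; rewrite eqxx.
- by exists (widen_ord (leqnSn n) j); rewrite eqxx partial_sum_extend.
by exists ord_max; rewrite eqxx partial_sum_last.
Qed.

Lemma path_sign_extend : path_sign lam' =
  path_sign lam * (if b then 1 else -1) *
  (if path_end lam + sign_val b == 0 then -1 else 1).
Proof.
rewrite /path_sign big_ord_recr /= path_extend_max.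
rewrite [\prod_(i in _) _]big_mkcond big_ord_recr /= inE partial_sum_last.
rewrite [X in X * _ * _ = _](eq_bigr (fun i => if lam i then 1 else -1)); last first.
  by move=> i _; rewrite path_extend_widen.
rewrite [X in _ * (X * _) = _](eq_bigr (fun i => if i \in return_set lam then -1 else 1)).
  by rewrite -big_mkcond /=; ring.
by move=> i _; rewrite !inE partial_sum_extend.
Qed.

Lemma partial_sum_extend_ge0 : [forall i, 0 <= partial_sum lam' i] =
  [forall i, 0 <= partial_sum lam i] && (0 <= path_end lam + sign_val b).
Proof.
apply/forallP/andP => [H|[/forallP H Hn] i].
  split; last by rewrite -partial_sum_last.
  by apply/forallP => i; rewrite -partial_sum_extend.
case: (unliftP ord_max i) => [j|] ->; last by rewrite partial_sum_last.
by rewrite -widen_lift partial_sum_extend.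
Qed.

End Extend.

Lemma returns_at_lt n (lam : {ffun 'I_n -> bool}) i : returns_at lam i -> (i < n)%N.
Proof. by case/existsP=> j /andP[/eqP <- _]. Qed.

Lemma path_validP n w (lam : {ffun 'I_n -> bool}) :
  reflect ((forall i, (i < n)%N ->
      nth false (d_mask w) i = returns_at lam i || returns_at lam i.+1) /\
      [forall i, 0 <= partial_sum lam i])
    (path_valid w lam).
Proof.
have retE (i : 'I_n) : (i \in return_set lam :|: pred_set (return_set lam)) =
    returns_at lam i || returns_at lam i.+1.
  rewrite !inE; congr (_ || _).
    apply/idP/existsP => [pi|[j /andP[/eqP/val_inj-> //]]].
    by exists i; rewrite eqxx.
  apply/exists_inP/existsP => [[j]|[j /andP[ji pj]]].
    by rewrite inE => pj ji; exists j; rewrite ji.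
  by exists j; rewrite ?inE.
apply: (iffP andP) => -[H ->]; split=> //.
  move=> i lt_in; have := congr1 (fun A : {set 'I_n} => Ordinal lt_in \in A) (eqP H).
  by rewrite retE inE.
by apply/eqP/setP => i; rewrite retE inE H.
Qed.

(** The last position is not covered by a d, so the path does not end at 0; being nonnegative, it
    ends above 0. *)
Lemma path_valid_c n w (lam : {ffun 'I_n -> bool}) b : cd_degree w = n ->
  path_valid (rcons w Lc) (path_extend lam b) =
  path_valid w lam && (0 < path_end lam + sign_val b).
Proof.
move=> deg_w; have sz := size_d_mask w; rewrite deg_w in sz.
apply/path_validP/andP => [[H]|[/path_validP[H nonneg] pos]].
  rewrite partial_sum_extend_ge0 => /andP[nonneg le0].
  have := H n (ltnSn n); rewrite d_mask_rcons nth_cat sz ltnn subnn /= !returns_at_extend.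
  rewrite eqxx (gtn_eqF (ltnSn n)) /= orbF.
  case: (_ =P 0 :> int) => [|ne0 _]; first by rewrite orbT.
  split; last by rewrite lt_neqAle le0 andbT eq_sym; apply/eqP.
  apply/path_validP; split=> // i lt_in.
  have := H i (leqW lt_in); rewrite d_mask_rcons nth_cat sz lt_in => ->.
  by rewrite !returns_at_extend; move/eqP/negPf: ne0 => ->; rewrite !andbF !orbF.
rewrite partial_sum_extend_ge0 nonneg (ltW pos); split=> // i lt_in.
rewrite !returns_at_extend (gt_eqF pos) !andbF !orbF d_mask_rcons nth_cat sz.
case: ltnP => [|le_ni]; first exact: H.
have -> : i = n by lia.
rewrite subnn /=; apply/esym/negbTE; rewrite negb_or.
by apply/andP; split; apply/negP => /returns_at_lt; lia.
Qed.

(** The last position is covered and has no successor, so it must be a return, which then covers the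
    position before it as well. *)
Lemma path_valid_d n w (lam : {ffun 'I_n -> bool}) b1 b2 : cd_degree w = n ->
  path_valid (rcons w Ld) (path_extend (path_extend lam b1) b2) =
  [&& path_valid w lam, 0 <= path_end lam + sign_val b1 &
      path_end lam + sign_val b1 + sign_val b2 == 0].
Proof.
move=> deg_w; have sz := size_d_mask w; rewrite deg_w in sz.
(* Consecutive partial sums cannot both vanish. *)
have ne0 : path_end lam + sign_val b1 + sign_val b2 == 0 ->
    (path_end lam + sign_val b1 == 0) = false.
  move=> /eqP; case: b2 => /=; lia.
have nret i : (n <= i)%N -> returns_at lam i = false.
  by apply: contraTF => /returns_at_lt; rewrite ltnNge.
apply/path_validP/and3P => [[H]|[/path_validP[H nonneg] pos end0]].
  rewrite !partial_sum_extend_ge0 path_end_extend => /andP[/andP[nonneg le1] le2].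
  have := H n.+1 (ltnSn _); rewrite d_mask_rcons nth_cat sz ltnNge leqnSn /= subSnn /=.
  rewrite !returns_at_extend !path_end_extend eqxx !nret //= ?leqW //.
  rewrite (gtn_eqF (ltnSn n)) (gtn_eqF (ltnSn n.+1)) (gtn_eqF (leqnSn n.+1)) /= orbF.
  move=> /esym end0; split=> //; apply/path_validP; split=> // i lt_in.
  have := H i (leqW (leqW lt_in)); rewrite d_mask_rcons nth_cat sz lt_in => ->.
  rewrite !returns_at_extend !path_end_extend (ne0 end0) !andbF !orbF.
  by rewrite (ltn_eqF (leqW lt_in)) eqSS (ltn_eqF lt_in) !orbF.
rewrite !partial_sum_extend_ge0 path_end_extend nonneg pos (eqP end0).
split=> // i lt_in.
rewrite !returns_at_extend !path_end_extend (ne0 end0) end0 !andbF !andbT !orbF.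
rewrite d_mask_rcons nth_cat sz; case: ltnP => [lt|le_ni].
  by rewrite (ltn_eqF (leqW lt)) eqSS (ltn_eqF lt) !orbF H.
rewrite !nret ?leqW //= eqSS.
by have [->|->] : i = n \/ i = n.+1 by [lia]; rewrite ?subnn ?subSnn /= eqxx ?orbT.
Qed.

Definition path_coef n w (k : int) : int :=
  \sum_(lam : {ffun 'I_n -> bool} | path_valid w lam && (path_end lam == k)) path_sign lam.

(** The last step goes up from k - 1 with sign 1 or down from k + 1 with sign -1, and creates no
    return. *)
Lemma path_coef_c n w (k : nat) : cd_degree w = n ->
  path_coef n.+1 (rcons w Lc) k =
  if k is k'.+1 then path_coef n w k' - path_coef n w k.+1 else 0.
Proof.
move=> deg_w; rewrite /path_coef sum_path_extend.
case: k => [|k].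
  apply: big1 => lam _; rewrite !path_valid_c // !path_end_extend.
  by rewrite ![_ && (_ == 0)]andbC; do 2!case: eqP => [->|_]; rewrite /= ?ltxx ?andbF ?addr0.
rewrite -sumrN [X in _ = X + _]big_mkcond [X in _ = _ + X]big_mkcond -big_split /=.
apply: eq_bigr => lam _; rewrite !path_valid_c // !path_end_extend /=.
have -> : (path_end lam + 1 == k.+1%:Z) = (path_end lam == k) by lia.
have -> : (path_end lam - 1 == k.+1%:Z) = (path_end lam == k.+2) by lia.
congr (_ + _).
  case: (path_end lam =P k) => [ek|_]; last by rewrite !andbF.
  rewrite path_sign_extend ek /=.
  have -> : (k%:Z + 1 == 0) = false by lia.
  by have -> : 0 < k%:Z + 1 by [lia]; rewrite !andbT !mulr1.
case: (path_end lam =P k.+2) => [ek|_]; last by rewrite !andbF.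
rewrite path_sign_extend ek /=.
by have -> : 0 < k.+2%:Z - 1 by [lia]; rewrite !andbT mulr1 mulrN1.
Qed.

(** The last step must go down from height 1, so the path was at 0 or 2 two steps before. The return
    makes the sign of up-down 1 and that of down-down -1. *)
Lemma path_coef_d n w (k : nat) : cd_degree w = n ->
  path_coef n.+2 (rcons w Ld) k =
  if k == 0%N then path_coef n w 0 - path_coef n w 2 else 0.
Proof.
move=> deg_w; rewrite /path_coef !sum_path_extend.
pose E (lam : {ffun 'I_n -> bool}) b1 b2 : int :=
  if path_valid (rcons w Ld) (path_extend (path_extend lam b1) b2) &&
     (path_end (path_extend (path_extend lam b1) b2) == k)
  then path_sign (path_extend (path_extend lam b1) b2) else 0.
transitivity (\sum_lam ((E lam true true + E lam true false) +
   (E lam false true + E lam false false))); first by [].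
have Etrue lam b : E lam b true = 0.
  rewrite /E path_valid_d // !path_end_extend.
  by case: ifP => // /andP[/and3P[_ le0 /eqP]] /=; lia.
have -> : forall x y : int, (if k == 0%N then x - y else 0) =
    (if k == 0%N then x else 0) + (if k == 0%N then - y else 0).
  by move=> x y; case: eqP; rewrite ?addr0.
have sum_if (P : pred {ffun 'I_n -> bool}) (F : {ffun 'I_n -> bool} -> int) (c : bool) :
    (if c then \sum_(lam | P lam) F lam else 0) = \sum_lam (if P lam && c then F lam else 0).
  case: c; first by rewrite big_mkcond; under eq_bigr => lam _ do rewrite -[P lam]andbT.
  by rewrite big1 // => lam _; rewrite andbF.
rewrite -sumrN !sum_if -big_split /=; apply: eq_bigr => lam _.
rewrite !Etrue !add0r /E {E Etrue} !path_valid_d // !path_end_extend /=.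
congr (_ + _).
  case: (path_end lam =P 0) => [ek|ne]; last first.
    case: ifP => [/andP[/and3P[_ _ /eqP eq0]]|_]; first by exfalso; apply: ne; lia.
    by rewrite andbF.
  rewrite !path_sign_extend path_end_extend ek /=.
  have -> : (0 + 1 - 1 == k%:Z) = (k == 0%N) by case: k.
  by rewrite !andbT !mulr1 !mulrN1 opprK.
case: (path_end lam =P 2) => [ek|ne]; last first.
  case: ifP => [/andP[/and3P[_ _ /eqP eq0]]|_]; first by exfalso; apply: ne; lia.
  by rewrite andbF.
rewrite !path_sign_extend path_end_extend ek /= !andbT.
have -> : (2 - 1 - 1 == k%:Z) = (k == 0%N) by case: k.
by rewrite !mulr1 !mulrN1 opprK.
Qed.

(** Both sides are 1 at k = 0 and 0 elsewhere for the empty word, and obey the same rules for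
    appending c and d. *)
Lemma path_coef_toric w (k : nat) : (path_coef (cd_degree w) w k)%:~R =
  short_coef (cd_degree w) (toric_ab (cd_degree w) (cd_word_value w)) k.
Proof.
elim/last_ind: w k => [|w l IH] k.
  rewrite /cd_degree big_nil /cd_word_value big_nil toric_ab1 /short_coef coef1.
  pose lam0 : {ffun 'I_0 -> bool} := [ffun _ => true].
  have eq0 lam : lam = lam0 by apply/ffunP; case.
  rewrite /path_coef big_mkcond (big_pred1 lam0) => [|lam]; last first.
    by rewrite /= (eq0 lam) eqxx.
  have -> : path_valid [::] lam0 by apply/path_validP; split=> //; apply/forallP; case.
  have -> : path_sign lam0 = 1 by rewrite /path_sign big_ord0 mul1r big1 //; case.
  rewrite /path_end big_ord0 leqn0 eq_sym /= eqz_nat.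
  by case: k.
have palF := palindromic_toric_cd w.
rewrite cd_degree_rcons cd_word_value_rcons; case: l; rewrite ?addn1 ?addn2.
  rewrite toric_abMc short_coef_step_c // path_coef_c //.
  by case: k => // k; rewrite rmorphB /= !IH.
rewrite toric_abMd short_coef_step_d // path_coef_d //.
by case: ifP => // _; rewrite rmorphB /= !IH.
Qed.

Lemma path_valid_end n w (lam : {ffun 'I_n -> bool}) :
  path_valid w lam -> 0 <= path_end lam <= n.
Proof.
case/path_validP=> _ /forallP nonneg; apply/andP; split.
  case: n lam nonneg => [|n] lam nonneg; first by rewrite /path_end big_ord0.
  have := nonneg ord_max; rewrite /partial_sum (eq_bigl predT) // => j.
  by rewrite -ltnS ltn_ord.
have -> : n%:Z = \sum_(i < n) 1 by rewrite sumr_const card_ord natz.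
by apply: ler_sum => i _; case: (lam i).
Qed.

Lemma weightE n (K : fieldType) (x : K) (lam : {ffun 'I_n -> bool}) : x != 0 ->
  weight x lam = (path_sign lam)%:~R * x ^ path_end lam.
Proof.
move=> x0; rewrite /weight /path_sign rmorphM /= !rmorph_prod /=.
have -> : x ^ path_end lam = \prod_(i < n) x ^ sign_val (lam i).
  by apply: (big_morph (fun m => x ^ m)) => [a b|//]; rewrite expfzDr.
rewrite mulrAC -big_split /=; congr (_ * _).
  by apply: eq_bigr => i _; case: (lam i); rewrite /= ?expr1z ?mul1r.
Qed.

Lemma short_toric_wordE n (K : fieldType) (x : K) w : x != 0 ->
  short_toric_word n x w = \sum_(k < n.+1) (path_coef n w k)%:~R * x ^+ k.
Proof.
move=> x0; rewrite /short_toric_word.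
transitivity (\sum_(lam : {ffun 'I_n -> bool} | path_valid w lam)
    \sum_(k < n.+1) (if path_end lam == k then (path_sign lam)%:~R * x ^+ k else 0)).
  apply: eq_bigr => lam /path_valid_end; case E: (path_end lam) => [m|//] /= le_mn.
  rewrite (bigD1 (Ordinal (le_mn : m < n.+1)%N)) //= eqxx big1 ?addr0 => [|k].
    by rewrite weightE // E.
  by rewrite -val_eqE /= eq_sym eqz_nat => /negPf->.
rewrite exchange_big /=; apply: eq_bigr => k _.
by rewrite /path_coef rmorph_sum mulr_suml [RHS]big_mkcondr.
Qed.

End SignPaths.

(** * The short toric polynomial *)

Section ShortToric.
Implicit Types (f q : {poly rat}) (n : nat).

Definition short_poly n f : {poly rat} := \poly_(k < n.+1) short_coef n f k.

Lemma short_poly_is_linear n : linear (short_poly n).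
Proof.
move=> c p q; apply/polyP => i; rewrite coefD coefZ !coef_poly /short_coef.
by do 2!(case: ifP => _; rewrite ?coefD ?coefZ ?mulr0 ?addr0 //).
Qed.

HB.instance Definition _ n := GRing.isLinear.Build rat {poly rat} {poly rat} _
  (short_poly n) (@short_poly_is_linear n).

Lemma eval_ratfunE m q (y : ratfun) : (size q <= m)%N ->
  eval_ratfun q y = \sum_(i < m) (q`_i)%:P%:F * y ^+ i.
Proof.
move=> szq; rewrite /eval_ratfun.
rewrite (@horner_coef_wide _ m); last by apply: leq_trans szq; apply: size_poly.
by apply: eq_bigr => i _; rewrite coef_map_id0 ?rmorph0.
Qed.

(* [palindrome_poly n q] is [x^n (q(x) + q(1/x) - q(0))]. *)
Definition palindrome_poly n q : {poly rat} :=
  q * 'X^n + \poly_(i < n.+1) q`_(n - i) - q`_0 *: 'X^n.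

Lemma coef_palindrome_poly n q i :
  (palindrome_poly n q)`_i = if (i < n)%N then q`_(n - i) else q`_(i - n).
Proof.
rewrite /palindrome_poly !(coefD, coefN) coefMXn coef_poly coefZ coefXn ltnS.
case: ltngtP => [lt_in|lt_ni|->].
- by rewrite mulr0 subr0 add0r.
- by rewrite mulr0 subr0 addr0.
by rewrite subnn mulr1 addrK.
Qed.

Lemma palindrome_polyE n q : (size q <= n.+1)%N ->
  'X%:F ^+ n * (eval_ratfun q 'X%:F + eval_ratfun q ('X%:F)^-1 - eval_ratfun q 0) =
  (palindrome_poly n q)%:F.
Proof.
move=> szq; have X0 : 'X%:F != 0 :> ratfun by rewrite tofrac_eq0 polyX_eq0.
have qE : q = \poly_(i < n.+1) q`_i.
  apply/polyP => i; rewrite coef_poly; case: ltnP => // ni.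
  by rewrite nth_default // (leq_trans szq).
rewrite /palindrome_poly !(rmorphD, rmorphN) mulrBr mulrDr; congr (_ + _ - _).
- rewrite (eval_ratfunE _ szq) rmorphM rmorphXn /= mulrC; congr (_ * _).
  rewrite [in RHS]qE poly_def rmorph_sum; apply: eq_bigr => i _.
  by rewrite /= -mul_polyC rmorphM rmorphXn.
- rewrite (eval_ratfunE _ szq) poly_def rmorph_sum mulr_sumr /= (reindex_inj rev_ord_inj) /=.
  apply: eq_bigr => i _; rewrite !subSS -mul_polyC rmorphM rmorphXn /=.
  rewrite mulrCA; congr (_ * _).
  by rewrite exprVn -expfB_cond ?(negPf X0) ?leq_subr ?subKn // -ltnS.
rewrite (eval_ratfunE _ szq) big_ord_recl expr0 mulr1 big1 => [|i _].
  by rewrite addr0 -mul_polyC rmorphM rmorphXn mulrC.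
by rewrite exprS mul0r mulr0.
Qed.

Lemma eval_ratfun_sqr f : eval_ratfun f ('X%:F ^+ 2) = (f \Po 'X^2)%:F.
Proof.
rewrite (eval_ratfunE _ (leqnn _)) comp_polyE rmorph_sum; apply: eq_bigr => i _.
by rewrite /= -mul_polyC rmorphM !rmorphXn.
Qed.

Lemma coef_comp_polyNX q i : (q \Po - 'X)`_i = (-1) ^+ i * q`_i.
Proof.
rewrite comp_polyE (eq_bigr (fun j : 'I_(size q) => ((-1) ^+ j * q`_j) *: 'X^j)).
  rewrite -(poly_def _ (fun j => (-1) ^+ j * q`_j)) coef_poly; case: ltnP => // szi.
  by rewrite nth_default // mulr0.
move=> j _; rewrite [(- 'X) ^+ j]exprNn -!mul_polyC polyCM polyC_exp polyCN polyC1 mulrA.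
by rewrite [_%:P * _]mulrC.
Qed.

(** Clearing denominators turns the relation between rational functions into an identity of
    polynomials. *)
Lemma is_short_toricE n f q : is_short_toric n f q <->
  [/\ size q = n.+1, q = (-1) ^+ n *: (q \Po - 'X) & f \Po 'X^2 = palindrome_poly n q].
Proof.
split=> -[szq par E]; split=> //.
  apply/eqP; rewrite -tofrac_eq -palindrome_polyE ?szq // -E.
  by rewrite eval_ratfun_sqr.
by rewrite palindrome_polyE ?szq // -E eval_ratfun_sqr.
Qed.

(** The top coefficient of the short form is f_0 = f_n, whence the exact size; palindromicity
    supplies the upper half of the coefficients of f(x^2). *)
Lemma short_poly_is_short_toric n f : palindromic n f -> f`_n != 0 ->
  is_short_toric n f (short_poly n f).
Proof.
move=> palf fn0; have fn : f`_n = f`_0 by rewrite palf leqnn subnn.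
apply/is_short_toricE; split.
- apply/eqP; rewrite eqn_leq size_poly /= ltnNge; apply: contra fn0 => /leq_sizeP H.
  have := H n (leqnn n); rewrite coef_poly ltnSn /short_coef leqnn subnn /=.
  by rewrite fn => ->.
- apply/polyP => k; rewrite coefZ coef_comp_polyNX coef_poly ltnS /short_coef.
  case: ifP => [le_kn|]; rewrite ?mulr0 //; case: ifP => [even_nk|]; rewrite ?mulr0 //.
  rewrite mulrA -exprD -signr_odd (_ : odd (n + k) = false) ?mul1r //.
  by lia.
apply/polyP => i; rewrite coef_comp_poly_Xn // dvdn2 divn2 coef_palindrome_poly !coef_poly.
rewrite /short_coef !ltnS; case: ltnP => [lt_in|le_ni].
  by rewrite leq_subr subKn // ltnW.
case: leqP => [le_in|lt_ni]; last first.
  case: ifP => // even_i; rewrite palf (_ : (i./2 <= n)%N = false) //.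
  by move: even_i lt_ni; lia.
rewrite (_ : odd (n - (i - n)) = odd i); last by lia.
case: ifP => // even_i; rewrite palf (_ : (i./2 <= n)%N); last by lia.
by congr (_`_ _); lia.
Qed.

(** From degree n on, [palindrome_poly n q] lists the coefficients of q. *)
Lemma is_short_toric_inj n f q1 q2 :
  is_short_toric n f q1 -> is_short_toric n f q2 -> q1 = q2.
Proof.
move=> /is_short_toricE[_ _ E1] /is_short_toricE[_ _ E2]; apply/polyP => j.
have := congr1 (fun p : {poly rat} => p`_(n + j)) (etrans (esym E1) E2).
by rewrite !coef_palindrome_poly ltnNge leq_addr addKn.
Qed.

Lemma short_toricE {d : Order.disp_t} {T : finTBPOrderType d} (rho : T -> nat) n :
  palindromic n (toric_f rho \top%O) -> (toric_f rho \top%O)`_n != 0 ->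
  short_toric rho n = short_poly n (toric_f rho \top%O).
Proof.
move=> palf fn0; apply: the_eq; first exact: short_poly_is_short_toric.
move=> q Hq; apply: is_short_toric_inj Hq _; exact: short_poly_is_short_toric.
Qed.

End ShortToric.

(** The summand of [\bot] is (x-1)^n. Any other summand has degree at most (rho q - 1)/2 + n - rho q
    < n. *)
Lemma lead_toric_f {d : Order.disp_t} {T : finTBPOrderType d} (rho : T -> nat) n :
  graded rho -> rho \top%O = n.+1 -> (toric_f rho \top%O)`_n = 1.
Proof.
move=> rho_graded rank_top.
have top0 : \top%O != \bot%O :> T by rewrite -(rank_gt0 rho_graded) rank_top.
have szX k : size (('X - 1) ^+ k : {poly rat}) = k.+1 by rewrite -polyC1 size_exp_XsubC.
rewrite /toric_f (negPf top0) (bigD1 \bot%O) ?lt0x //= toric_g_bot mul1r.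
rewrite rho_graded.1 rank_top subn0 subn1 /= coefD.
have -> : (('X - 1) ^+ n : {poly rat})`_n = 1.
  have := monicP (monic_exp n (monicXsubC (1 : rat))).
  by rewrite /lead_coef polyC1 szX.
rewrite coef_sum big1 ?addr0 // => q /andP[qt q0].
have := rank_lt rho_graded qt; rewrite rank_top ltnS => le_qn.
have : (0 < rho q)%N by rewrite rank_gt0.
move=> rq; rewrite nth_default //; apply: leq_trans (size_polyMleq _ _) _.
rewrite szX addnS /= toric_gE //.
have := size_poly ((rho q).-1)./2.+1
  (fun i => (toric_f rho q)`_i - (if i is j.+1 then (toric_f rho q)`_j else 0)).
rewrite poly_def -/(toric_truncate (rho q) (toric_f rho q)) => szg.
by apply: leq_trans (leq_add szg (leqnn _)) _; lia.
Qed.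

Lemma leq_size_cd_degree (w : seq cd_letter) : (size w <= cd_degree w)%N.
Proof. by rewrite /cd_degree -sum1_size; apply: leq_sum => -[]. Qed.

(** Words of other degrees are killed by the functional ([toric_ab_cd_neq]), and words outside the
    support have coefficient 0. *)
Lemma toric_ab_cd_subst n (Phi : cd_poly) :
  toric_ab n (cd_subst Phi) =
  \sum_(w : n.-bseq cd_letter | cd_degree w == n)
     Phi@_(FMonom w) *: toric_ab n (cd_word_value w).
Proof.
pose F (w : {fmonom cd_letter}) := Phi@_w *: toric_ab n (cd_word_value w).
transitivity (\sum_(w <- msupp Phi | cd_degree w == n) F w).
  rewrite cd_substE (raddf_sum (toric_ab n)) [RHS]big_mkcond /=.
  apply: eq_bigr => w _; rewrite [LHS]toric_abZ /F eq_sym; case: eqP => // /eqP ne_nw.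
  by rewrite [toric_ab _ _]toric_ab_cd_neq ?scaler0.
transitivity (\sum_(w : n.-bseq cd_letter |
    (cd_degree w == n) && (FMonom w \in msupp Phi)) F (FMonom w)); last first.
  rewrite big_mkcondr; apply: eq_bigr => w _; case: ifPn => // /mcoeff_outdom Phi0.
  by rewrite Phi0 scale0r.
rewrite -big_filter -[RHS]big_filter.
rewrite -(big_map (fun w : n.-bseq cd_letter => FMonom w) predT F).
apply: perm_big; apply: uniq_perm.
- by rewrite filter_uniq ?fset_uniq.
- rewrite map_inj_uniq ?filter_uniq ?index_enum_uniq // => u v [] uv.
  exact: val_inj.
move=> w; rewrite mem_filter; apply/andP/mapP => [[/eqP deg_w wPhi]|[v]].
  have szw : (size w <= n)%N by rewrite -deg_w leq_size_cd_degree.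
  exists (Bseq szw); last by rewrite /= fmK.
  by rewrite mem_filter mem_index_enum /= deg_w eqxx andbT fmK.
by rewrite mem_filter => /andP[/andP[deg_v vPhi] _] ->.
Qed.

(* A word of degree n has length at most n, so the words of degree n are among *)
(* the bounded sequences n.-bseq cd_letter.                                    *)
Theorem theorem4p3 (d : Order.disp_t) (T : finTBPOrderType d)
    (rho : T -> nat) (n : nat)
    (rho_graded : graded rho) (rho_eulerian : eulerian rho)
    (rank_top : rho \top%O = n.+1) :
  (short_toric rho n)%:F =
  \sum_(w : n.-bseq cd_letter | cd_degree w == n)
     ((cd_index rho n)@_(FMonom w))%:P%:F *
     short_toric_word n ('X%:F : ratfun) w.
Proof.
have top0 : \top%O != \bot%O :> T by rewrite -(rank_gt0 rho_graded) rank_top.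
have toricE : toric_f rho \top%O = \sum_(w : n.-bseq cd_letter | cd_degree w == n)
     (cd_index rho n)@_(FMonom w) *: toric_ab n (cd_word_value w).
  rewrite (toric_f_chain_sum rho_graded top0) rank_top.
  by rewrite -(cd_index_subst rho_graded rho_eulerian rank_top) toric_ab_cd_subst.
have palf : palindromic n (toric_f rho \top%O).
  move=> i; rewrite toricE !coef_sum; case: ifP => le_in.
    apply: eq_bigr => w /eqP deg_w; rewrite !coefZ; congr (_ * _).
    by have := palindromic_toric_cd w i; rewrite deg_w le_in.
  apply: big1 => w /eqP deg_w; rewrite coefZ.
  by have := palindromic_toric_cd w i; rewrite deg_w le_in => ->; rewrite mulr0.
rewrite short_toricE ?(lead_toric_f rho_graded rank_top) ?oner_eq0 //.
(* Linearity of the short form reduces the claim to one cd-word. *)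
rewrite {1}toricE linear_sum rmorph_sum; apply: eq_bigr => w /eqP deg_w.
rewrite /= linearZ /= -mul_polyC rmorphM; congr (_ * _).
have X0 : 'X%:F != 0 :> ratfun by rewrite tofrac_eq0 polyX_eq0.
rewrite (short_toric_wordE _ _ X0) /short_poly poly_def rmorph_sum; apply: eq_bigr => k _.
rewrite /= -mul_polyC rmorphM rmorphXn /=; congr (_ * _).
by have := path_coef_toric w k; rewrite deg_w => <-; rewrite !rmorph_int.
Qed.
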